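(* Let $G=(V,E)$ be an unweighted graph on $n$ vertices that is a $\zeta$-expander with minimum degree $d_{\min}\ge4\cdot10^6\cdot\zeta^{-1}n^{\frac{32}{\log\log n}}$ for some $\zeta\le\frac1{\log n}$. For an $s\ge\frac{4\cdot10^6\cdot\zeta^{-1}n^{\frac{32}{\log\log n}}}{d_{\min}}\cdot n$, let $C$ be a uniformly random vertex subset of size $s$. Then with probability $1-n^{-7}$, the induced subgraph $G[C]$ is a $\zeta/n^{\frac{1024}{\log\log n}}$-expander with minimum degree at least $\frac{s}{2n}\cdot d_{\min}$.
   Context: For an unweighted graph with degree matrix $D$ (diagonal, $D_{uu}$ = degree of $u$) and Laplacian $L=D-A$, the normalized Laplacian is $N=D^{-1/2}LD^{-1/2}$. The graph is a $\zeta$-expander ($0<\zeta\le1$) if the second smallest eigenvalue of $N$ is at least $\zeta$. $G[C]$ is the subgraph induced by $C$, whose normalized Laplacian uses its own degrees. *)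

(* Defs.v *)
From mathcomp Require Import all_boot all_order all_algebra.
From mathcomp Require Import polyrcf.
From mathcomp Require Import reals exp.

Set Implicit Arguments.
Unset Strict Implicit.
Unset Printing Implicit Defensive.

Import Order.TTheory GRing.Theory Num.Theory.

Local Open Scope ring_scope.

(* A finite simple graph is a symmetric irreflexive relation on a finType;
   its matrices are indexed through enum_val : 'I_#|V| -> V. *)
Section Graph.
Variables (V : finType) (e : rel V).

Definition degree (u : V) : nat := #|[set v | e u v]|.

(* Degrees are at most #|V|, so the neutral element is harmless when V is
   nonempty. *)
Definition min_degree : nat := \big[minn/#|V|]_(u : V) degree u.

Definition induced (C : {set V}) : rel {u : V | u \in C} :=
  [rel u v | e (val u) (val v)].

Variable R : realType.

Definition adjacency_mx : 'M[R]_#|V| :=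
  \matrix_(i, j) (e (enum_val i) (enum_val j))%:R.

Definition degree_mx : 'M[R]_#|V| :=
  diag_mx (\row_i (degree (enum_val i))%:R).

Definition laplacian_mx : 'M[R]_#|V| := degree_mx - adjacency_mx.

(* D^{-1/2}; since 0^-1 = 0, isolated vertices get the entry 0. *)
Definition degree_invsqrt_mx : 'M[R]_#|V| :=
  diag_mx (\row_i (Num.sqrt (degree (enum_val i))%:R)^-1).

Definition normalized_laplacian_mx : 'M[R]_#|V| :=
  degree_invsqrt_mx *m laplacian_mx *m degree_invsqrt_mx.

End Graph.

Arguments induced {V} e C.

(* The real eigenvalues in nondecreasing order (rootsR is sorted), repeated
   according to their algebraic multiplicity. *)
Definition eigenvalues (R : realType) (n : nat) (A : 'M[R]_n) : seq R :=
  flatten [seq nseq (mup x (char_poly A)) x | x <- rootsR (char_poly A)].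

(* On a graph with a single vertex there is no second eigenvalue; the default
   value 0 then makes the graph not an expander. *)
Definition expander (R : realType) (zeta : R) (V : finType) (e : rel V) : bool :=
  (0 < zeta <= 1) && (zeta <= (eigenvalues (normalized_laplacian_mx e R))`_1).

Definition prob_random_subset (R : realType) (V : finType) (s : nat)
    (P : pred {set V}) : R :=
  #|[set C : {set V} | (#|C| == s) && P C]|%:R
    / #|[set C : {set V} | #|C| == s]|%:R.

(* Main.v *)
Require Import Defs.
From mathcomp Require Import all_boot all_order all_algebra.
From mathcomp Require Import complex polyrcf.
From mathcomp Require Import boolp reals sequences exp.
From mathcomp Require Import ring lra zify.

(* Let C1, C2, C3 be independent Bernoulli(q) subsets whose union C
   is Bernoulli(s/n), and pass to the triple cover of G on V x {1,2,3}, in which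
   there are no edges inside a layer. The layers are thinned one after the
   other. Eliminating the vertices of a layer from the Dirichlet form replaces
   each of them by a clique on its neighbours (a Schur complement), so thinning
   a layer becomes a sum of independent positive semidefinite forms, and its
   lower tail is controlled, relative to the total form, by trace moments of
   order 2k with k about ln ln n. Each step costs a constant factor in the
   spectral gap, and a gap of the thinned triple cover yields one for G[C].
   Finally, a Bernoulli(s/n) set has size s with probability at least
   1/(n+1). *)

Set Implicit Arguments.
Unset Strict Implicit.
Unset Printing Implicit Defensive.

Import Order.TTheory GRing.Theory Num.Theory.

Local Open Scope ring_scope.

(** In G itself the thinned edge form is quadratic in the membership indicators, since both ends of
    an edge must survive. When one layer of the cover is thinned and the two others stay fixed, the
    form is linear in independent indicators, as a matrix moment bound requires. Two layers would
    not do: if G is bipartite, its double cover is disconnected. With three layers the walk on the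
    cover has the eigenvalues of the walk on G and -1/2 times these; the new ones are at most 1/2,
    so the gap survives without any control of the bottom of the spectrum. Moments of order 2k give
    tails of the form [n * rho ^ k]. With [K = n ^ (1 / ln ln n)] and k just above ln ln n one has
    [K ^ k >= n], so [rho = K ^- 20] absorbs the dimension and the union bounds. Of the factor
    [K ^ 32] in the degree hypothesis, [K ^ 20] pays for this rho and [K ^ 12] for the factor k in
    the moment bound. *)

Lemma scalar_mx11 (R : pzSemiRingType) (A : 'M[R]_1) : A = (A 0 0)%:M.
Proof. by apply/matrixP=> i j; rewrite !ord1 mxE eqxx. Qed.

Lemma mulmx_rv_trE (R : comPzRingType) n (u v : 'rV[R]_n) :
  (u *m v^T) 0 0 = \sum_i u 0 i * v 0 i.
Proof. by rewrite mxE; apply: eq_bigr => i _; rewrite mxE. Qed.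

Lemma normsq_ge0 (R : realDomainType) n (u : 'rV[R]_n) : 0 <= (u *m u^T) 0 0.
Proof. by rewrite mulmx_rv_trE; apply: sumr_ge0 => i _; rewrite -expr2 sqr_ge0. Qed.

Lemma normsq_eq0 (R : realDomainType) n (u : 'rV[R]_n) :
  ((u *m u^T) 0 0 == 0) = (u == 0).
Proof.
apply/idP/eqP => [|->]; last by rewrite mul0mx mxE.
rewrite mulmx_rv_trE psumr_eq0 => [/allP h|i _]; last by rewrite -expr2 sqr_ge0.
apply/rowP => i; rewrite mxE; apply/eqP.
by have := h i (mem_index_enum _); rewrite -expr2 sqrf_eq0.
Qed.

Lemma trmx11 (R : Type) (A : 'M[R]_1) : A^T = A.
Proof. by apply/matrixP=> i j; rewrite !ord1 mxE. Qed.

(** * Spectral theorem for real symmetric matrices *)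

Section RealSpectral.
Variable R : rcfType.

(** Over the complex extension an eigenvector [x + i y] exists. By symmetry, pairing [x *m A] with y
    and [y *m A] with x gives the same number, which forces the imaginary part b of the eigenvalue
    to vanish; then x and y both satisfy the real equation, and one of them is nonzero. *)
Lemma sym_real_eigenvector n (A : 'M[R]_n.+1) : A^T = A ->
  exists (a : R) (v : 'rV[R]_n.+1), v != 0 /\ v *m A = a *: v.
Proof.
move=> symA.
have [z /eigenvalueP[w wA w0]] :=
  eigenvalue_closed (map_mx (real_complex R) A) (ltn0Sn n).
pose x := map_mx (@complex.Re R) w; pose y := map_mx (@complex.Im R) w.
pose a := complex.Re z; pose b := complex.Im z.
have ReE (i : 'I_n.+1) : (x *m A) 0 i = a * x 0 i - b * y 0 i.
  move/matrixP/(_ 0 i)/(congr1 (@complex.Re R)): wA.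
  rewrite !mxE raddf_sum /=.
  have -> : complex.Re (z * w 0 i) =
     a * complex.Re (w 0 i) - b * complex.Im (w 0 i).
    by rewrite /a /b; case: (z) (w 0 i) => [? ?] [? ?].
  move=> <-; apply: eq_bigr => j _; rewrite !mxE.
  by case: (w 0 j) => p q /=; rewrite mulr0 subr0.
have ImE (i : 'I_n.+1) : (y *m A) 0 i = a * y 0 i + b * x 0 i.
  move/matrixP/(_ 0 i)/(congr1 (@complex.Im R)): wA.
  rewrite !mxE raddf_sum /=.
  have -> : complex.Im (z * w 0 i) =
     a * complex.Im (w 0 i) + b * complex.Re (w 0 i).
    by rewrite /a /b; case: (z) (w 0 i) => [? ?] [? ?].
  move=> <-; apply: eq_bigr => j _; rewrite !mxE.
  by case: (w 0 j) => p q /=; rewrite mulr0 add0r.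
have xA : x *m A = a *: x - b *: y.
  by apply/rowP => i; rewrite ReE !mxE.
have yA : y *m A = a *: y + b *: x.
  by apply/rowP => i; rewrite ImE !mxE.
have b0 : b = 0.
  have : (x *m A *m y^T) 0 0 = (y *m A *m x^T) 0 0.
    by rewrite -[y *m A *m _]trmxK trmx11 !trmx_mul trmxK symA mulmxA.
  rewrite xA yA mulmxBl mulmxDl -!scalemxAl.
  have -> : y *m x^T = x *m y^T.
    by rewrite -[LHS]trmx11 trmx_mul trmxK.
  rewrite !mxE => h.
  have {}h : b * ((x *m x^T) 0 0 + (y *m y^T) 0 0) = 0.
    by rewrite !mxE; lra.
  move/eqP: h; rewrite mulf_eq0 => /orP[/eqP //|].
  rewrite paddr_eq0 ?normsq_ge0 // !normsq_eq0 => /andP[/eqP x0 /eqP y0].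
  case/eqP: w0; apply/rowP => i; move/rowP/(_ i): x0; move/rowP/(_ i): y0.
  by rewrite !mxE; case: (w 0 i) => ? ? /= -> ->.
rewrite b0 !scale0r ?subr0 ?addr0 in xA yA.
have [x0|x0] := eqVneq x 0; last by exists a, x.
exists a, y; split=> //; apply: contraNneq w0 => y0.
apply/eqP/rowP => i; move/rowP/(_ i): x0; move/rowP/(_ i): y0.
by rewrite !mxE; case: (w 0 i) => ? ? /= -> ->.
Qed.

(* H is the Householder reflection along the difference of the two vectors. *)
Lemma unit_vector_reflection n (v : 'rV[R]_n.+1) : (v *m v^T) 0 0 = 1 ->
  exists H : 'M[R]_n.+1, [/\ H^T = H, H *m H = 1%:M & delta_mx 0 0 *m H = v].
Proof.
move=> v1; pose e0 : 'rV[R]_n.+1 := delta_mx 0 0.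
have [vE|v_neq] := eqVneq v e0.
  by exists 1%:M; rewrite vE; split; rewrite ?trmx1 ?mulmx1.
have [u uE] : {u | u = e0 - v} by exists (e0 - v).
pose c := (u *m u^T) 0 0.
have c0 : c != 0 by rewrite normsq_eq0 uE subr_eq0 eq_sym.
have uu : u *m u^T = c%:M by rewrite [LHS]scalar_mx11.
have e0u : (e0 *m u^T) 0 0 = 1 - v 0 0.
  by rewrite -rowE uE !mxE eqxx.
have vv : v *m v^T = 1%:M by rewrite [LHS]scalar_mx11 v1.
have ev : (e0 *m v^T) 0 0 = v 0 0 by rewrite -rowE !mxE.
have ve : (v *m e0^T) 0 0 = v 0 0 by rewrite -[v *m _]trmx11 trmx_mul trmxK.
have ee : (e0 *m e0^T) 0 0 = 1 by rewrite -rowE !mxE !eqxx.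
have cE : c = 2 * (1 - v 0 0).
  have mB (X Y : 'M[R]_1) : (X - Y) 0 0 = X 0 0 - Y 0 0 by rewrite !mxE.
  by rewrite /c uE linearB /= mulmxBl !mulmxBr !mB ee ev ve v1; ring.
exists (1%:M - (2 / c) *: (u^T *m u)); split.
- by rewrite linearB /= trmx1 linearZ /= trmx_mul trmxK.
- rewrite mulmxBl !mulmxBr !mul1mx !mulmx1 -!scalemxAl -!scalemxAr.
 rewrite scalerA -mulmxA (mulmxA u) uu mul_scalar_mx -scalemxAr scalerA.
  have -> : 2 / c * (2 / c) * c = 2 / c + 2 / c by field.
  by rewrite scalerDl; apply/matrixP => i j; rewrite !mxE; ring.
rewrite mulmxBr mulmx1 -scalemxAr mulmxA [e0 *m u^T]scalar_mx11 e0u.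
rewrite mul_scalar_mx scalerA -/e0.
have -> : 2 / c * (1 - v 0 0) = 1
  by rewrite cE in c0 *; field; move: c0; rewrite mulf_eq0 negb_or => /andP[].
by rewrite scale1r uE opprB addrC subrK.
Qed.

(** Deflation: conjugation by a reflection taking the first basis vector to a unit eigenvector
    clears the first row off the diagonal and, by symmetry, the first column. *)
Lemma real_spectral n (A : 'M[R]_n) : A^T = A ->
  exists (P : 'M[R]_n) (d : 'rV[R]_n),
    P *m P^T = 1%:M /\ A = P^T *m diag_mx d *m P.
Proof.
elim: n A => [|n IHn] A symA.
  by exists 1%:M, 0; split; apply/matrixP => -[].
have [a [v0 [v0_neq v0A]]] := sym_real_eigenvector symA.
pose r := Num.sqrt ((v0 *m v0^T) 0 0).
have r_gt0 : 0 < r.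
  by rewrite sqrtr_gt0 lt_neqAle normsq_ge0 eq_sym normsq_eq0 v0_neq.
pose v := r^-1 *: v0.
have vA : v *m A = a *: v by rewrite -scalemxAl v0A !scalerA mulrC.
have v1 : (v *m v^T) 0 0 = 1.
  have rr : (v0 *m v0^T) 0 0 = r ^+ 2 by rewrite sqr_sqrtr ?normsq_ge0.
  rewrite linearZ /= -scalemxAl -scalemxAr scalerA.
  have mZ k (X : 'M[R]_1) : (k *: X) 0 0 = k * X 0 0 by rewrite mxE.
  by rewrite mZ rr; field; rewrite gt_eqF.
have [H [symH HH eH]] := unit_vector_reflection v1.
have [B BE] : {B | B = H *m A *m H} by exists (H *m A *m H).
have symB : B^T = B by rewrite BE !trmx_mul symH symA mulmxA.
have AE : A = H *m B *m H.
  by rewrite BE !mulmxA HH mul1mx -mulmxA HH mulmx1.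
have rowB j : B 0 j = a * (j == 0)%:R.
  have -> : B 0 j = (delta_mx 0 0 *m B) (0 : 'I_1) j by rewrite -rowE [RHS]mxE.
  rewrite BE !mulmxA eH vA -scalemxAl -eH -mulmxA HH mulmx1 !mxE eqxx /=.
  by rewrite eq_sym.
have ls0 : lshift n (0 : 'I_1) = (0 : 'I_n.+1) by apply/val_inj.
pose B1 : 'M[R]_(1 + n) := B.
have Bblock : B1 = block_mx a%:M 0 0 (drsubmx B1).
  rewrite -[LHS]submxK; congr block_mx.
  - apply/matrixP => i j; rewrite !ord1 !mxE /=.
    by rewrite ls0 /B1 rowB eqxx mulr1.
  - apply/matrixP => i j; rewrite !ord1 !mxE.
    by rewrite ls0 /B1 rowB mulr0.
  - apply/matrixP => i j; rewrite !ord1 !mxE.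
    rewrite /B1 -symB mxE.
    by rewrite ls0 rowB mulr0.
have symB' : (drsubmx B1)^T = drsubmx B1 by rewrite trmx_drsub /B1 symB.
have [P' [d' [P'1 B'E]]] := IHn _ symB'.
pose Q : 'M[R]_(1 + n) := block_mx 1%:M 0 0 P'.
pose D : 'rV[R]_(1 + n) := row_mx a%:M d'.
have QQ : Q *m Q^T = 1%:M.
  rewrite /Q tr_block_mx !trmx0 trmx1 mulmx_block !mulmx0 !mul0mx mulmx1 P'1.
  by rewrite !addr0 add0r -scalar_mx_block.
have BQ : B1 = Q^T *m diag_mx D *m Q.
  rewrite Bblock B'E /Q /D diag_mx_row tr_block_mx !trmx0 trmx1.
  rewrite !mulmx_block !(mulmx0, mul0mx, mulmx1, mul1mx, addr0, add0r).
  by congr block_mx; apply/matrixP => i j; rewrite !ord1 !mxE.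
exists (Q *m H), D; split.
  by rewrite trmx_mul symH mulmxA -(mulmxA Q) HH mulmx1.
by rewrite trmx_mul symH [LHS]AE -[B]/B1 BQ !mulmxA.
Qed.

End RealSpectral.

(** * Trace inequalities for powers of symmetric matrices *)

Definition qform (R : pzRingType) n (A : 'M[R]_n) (v : 'rV[R]_n) : R :=
  (v *m A *m v^T) 0 0.

Section ScalarPowers.
Variable R : realFieldType.

(** For nonnegative x and y the two sides differ by [(x ^+ i - y ^+ i) * (x ^+ k - y ^+ k)];
    evenness of [i + k] permits passing to absolute values. *)
Lemma even_power_pairing (a b : R) i k : ~~ odd (i + k) ->
  a ^+ k * b ^+ i + a ^+ i * b ^+ k <= a ^+ (i + k) + b ^+ (i + k).
Proof.
move=> ev.
have evE (c : R) : c ^+ (i + k) = `|c| ^+ (i + k).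
  by rewrite -normrX ger0_norm // exprn_even_ge0.
rewrite (evE a) (evE b).
set x := `|a|; set y := `|b|.
apply: (@le_trans _ _ (x ^+ k * y ^+ i + x ^+ i * y ^+ k)).
  by apply: lerD; rewrite (le_trans (ler_norm _)) // normrM !normrX.
rewrite -subr_ge0.
have -> : x ^+ (i + k) + y ^+ (i + k) - (x ^+ k * y ^+ i + x ^+ i * y ^+ k)
   = (x ^+ i - y ^+ i) * (x ^+ k - y ^+ k) by rewrite !exprD; ring.
have x0 : 0 <= x := normr_ge0 a; have y0 : 0 <= y := normr_ge0 b.
have [xy|/ltW yx] := leP x y.
  by apply: mulr_le0; rewrite subr_le0 lerXn2r.
by apply: mulr_ge0; rewrite subr_ge0 lerXn2r.
Qed.

(** After factoring out [a - b], the cofactor sum is added to its own reversal, and each of the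
    [j.*2.+1] pairs is bounded by [even_power_pairing]. *)
Lemma odd_power_diff_le (a b : R) j :
  (a - b) * (a ^+ j.*2.+1 - b ^+ j.*2.+1) <=
  j.*2.+1%:R / 2 * ((a - b) ^+ 2 * (a ^+ j.*2 + b ^+ j.*2)).
Proof.
rewrite subrXX mulrA -expr2 mulrCA; apply: ler_wpM2l; first exact: sqr_ge0.
pose S := \sum_(i < j.*2.+1) a ^+ (j.*2 - i) * b ^+ i.
have SE : S = \sum_(i < j.*2.+1) a ^+ i * b ^+ (j.*2 - i).
  rewrite /S (reindex_inj rev_ord_inj) /=; apply: eq_bigr => i _.
  by rewrite subSS subKn // -ltnS.
suff : S + S <= j.*2.+1%:R * (a ^+ j.*2 + b ^+ j.*2) by rewrite /S /=; lra.
rewrite {2}SE -big_split /=.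
have -> : j.*2.+1%:R * (a ^+ j.*2 + b ^+ j.*2) =
    \sum_(i < j.*2.+1) (a ^+ j.*2 + b ^+ j.*2).
  by rewrite sumr_const card_ord mulr_natl.
apply: ler_sum => i _.
have ij : (i + (j.*2 - i))%N = j.*2 by rewrite subnKC // -ltnS.
by rewrite -[in leRHS]ij; apply: even_power_pairing; rewrite ij odd_double.
Qed.

End ScalarPowers.

Section QuadraticForms.
Variables (R : rcfType) (n : nat).
Implicit Types (A B X Y Z P : 'M[R]_n) (u v : 'rV[R]_n) (d : 'rV[R]_n).

Lemma qformE A v : qform A v = \sum_i \sum_j v 0 i * A i j * v 0 j.
Proof.
rewrite /qform mulmx_rv_trE exchange_big /=; apply: eq_bigr => j _.
by rewrite mxE mulr_suml.
Qed.

Lemma qform1 v : qform 1%:M v = (v *m v^T) 0 0.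
Proof. by rewrite /qform mulmx1. Qed.

Lemma qformD A B v : qform (A + B) v = qform A v + qform B v.
Proof. by rewrite /qform mulmxDr mulmxDl mxE. Qed.

Lemma qformZ a A v : qform (a *: A) v = a * qform A v.
Proof. by rewrite /qform -scalemxAr -scalemxAl mxE. Qed.

Lemma qform_sum (I : finType) (F : I -> 'M[R]_n) v :
  qform (\sum_i F i) v = \sum_i qform (F i) v.
Proof. by rewrite /qform mulmx_sumr mulmx_suml summxE. Qed.

Lemma scale_mulmxl a (X Y : 'M[R]_n) : (a *: X) * Y = a *: (X * Y).
Proof. by rewrite [RHS]scalemxAl. Qed.

Lemma scale_mulmxr a (X Y : 'M[R]_n) : X * (a *: Y) = a *: (X * Y).
Proof. by rewrite [RHS]scalemxAr. Qed.

Lemma qform_diag d v : qform (diag_mx d) v = \sum_i d 0 i * v 0 i ^+ 2.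
Proof.
rewrite /qform mulmx_rv_trE; apply: eq_bigr => i _.
rewrite mxE (bigD1 i) //= big1 => [|j ji].
  by rewrite mxE eqxx mulr1n addr0; ring.
by rewrite mxE (negPf ji) mulr0n mulr0.
Qed.

Lemma qform_conj m (A : 'M[R]_n) (P : 'M[R]_(m, n)) (v : 'rV[R]_m) :
  qform (P *m A *m P^T) v = qform A (v *m P).
Proof. by rewrite /qform trmx_mul !mulmxA. Qed.

Lemma qform_conj_tr m (A : 'M[R]_n) (P : 'M[R]_(n, m)) (v : 'rV[R]_m) :
  qform (P^T *m A *m P) v = qform A (v *m P^T).
Proof. by rewrite -{2}[P]trmxK qform_conj. Qed.

Lemma orthogonal_normsq P v : P *m P^T = 1%:M ->
  ((v *m P^T) *m (v *m P^T)^T) 0 0 = (v *m v^T) 0 0.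
Proof.
move=> /mulmx1C P1.
by rewrite trmx_mul trmxK mulmxA -(mulmxA v) P1 mulmx1.
Qed.

Lemma mulmx_orthogonal_mid (P D E : 'M[R]_n) : P *m P^T = 1%:M ->
  (P^T *m D *m P) *m (P^T *m E *m P) = P^T *m (D *m E) *m P.
Proof.
by move=> P1; rewrite !mulmxA -(mulmxA _ P) P1 mulmx1 -!mulmxA.
Qed.

Lemma spectral_exp P d k : P *m P^T = 1%:M ->
  (P^T *m diag_mx d *m P) ^+ k = P^T *m diag_mx (\row_i d 0 i ^+ k) *m P.
Proof.
move=> P1; elim: k => [|k IHk].
  rewrite expr0 (_ : diag_mx _ = 1%:M) ?mulmx1 ?(mulmx1C P1) //.
  by apply/matrixP => i j; rewrite !mxE expr0.
rewrite exprS IHk [LHS]mulmx_orthogonal_mid //; congr (_ *m _ *m _).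
rewrite mulmx_diag; congr diag_mx; apply/rowP => i.
by rewrite !mxE exprS.
Qed.

Lemma trmxX A k : (A ^+ k)^T = (A^T) ^+ k.
Proof.
elim: k => [|k IHk]; first by rewrite !expr0 trmx1.
by rewrite exprS exprSr -IHk [LHS]trmx_mul.
Qed.

Lemma mxtrace_mul_tr m (X Y : 'M[R]_(n, m)) :
  \tr (X *m Y^T) = \sum_a \sum_b X a b * Y a b.
Proof.
by apply: eq_bigr => a _; rewrite mxE; apply: eq_bigr => b _; rewrite mxE.
Qed.

(** The left and right bases may differ, since this is applied to two matrices that need not
    commute. *)
Lemma mxtrace_orthogonal P (Q X Y : 'M[R]_n) : P *m P^T = 1%:M -> Q *m Q^T = 1%:M ->
  \tr (X *m Y^T) =
    \sum_a \sum_b (P *m X *m Q^T) a b * (P *m Y *m Q^T) a b.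
Proof.
move=> /mulmx1C P1 /mulmx1C Q1; rewrite -mxtrace_mul_tr !trmx_mul trmxK.
rewrite !mulmxA -(mulmxA _ Q^T) Q1 mulmx1 [RHS]mxtrace_mulC !mulmxA P1.
by rewrite mul1mx.
Qed.

Lemma mxtrace_conj_ge0 Y (M : 'M[R]_n) : (forall v, 0 <= qform Y v) ->
  0 <= \tr (M *m Y *m M^T).
Proof.
move=> Y0; apply: sumr_ge0 => i _.
rewrite (_ : _ i i = qform Y (row i M)) //.
by rewrite /qform -row_mul mxE [RHS]mxE; apply: eq_bigr => j _; rewrite !mxE.
Qed.

(* In eigenbases P, Q of A and B every trace below is a sum of scalar terms
   weighted by the squared entries of P Q^T. *)
Lemma mxtrace_odd_power_diff (A B : 'M[R]_n) j : A^T = A -> B^T = B ->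
  \tr ((A - B) * (A ^+ j.*2.+1 - B ^+ j.*2.+1)) <=
  j.*2.+1%:R / 2 * \tr ((A - B) * (A - B) * (A ^+ j.*2 + B ^+ j.*2)).
Proof.
move=> symA symB.
have [P [a [P1 AE]]] := real_spectral symA.
have [Q [b [Q1 BE]]] := real_spectral symB.
have [U UE] : {U | U = P *m Q^T} by exists (P *m Q^T).
have PdQ (f g : 'rV[R]_n) x y :
  (P *m (P^T *m diag_mx f *m P - Q^T *m diag_mx g *m Q) *m Q^T) x y
    = (f 0 x - g 0 y) * U x y.
  rewrite mulmxBr mulmxBl !mulmxA P1 mul1mx -(mulmxA _ Q) Q1 mulmx1.
  rewrite -!mulmxA -UE mulmxA -UE mul_diag_mx mul_mx_diag !mxE; ring.
have subT k : (A ^+ k - B ^+ k)^T = A ^+ k - B ^+ k.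
  by rewrite linearB /= !trmxX symA symB.
have D1 : A - B = (A - B)^T by have := subT 1; rewrite !expr1.
have powA k : A ^+ k = P^T *m diag_mx (\row_i a 0 i ^+ k) *m P.
  by rewrite AE spectral_exp.
have powB k : B ^+ k = Q^T *m diag_mx (\row_i b 0 i ^+ k) *m Q.
  by rewrite BE spectral_exp.
have -> : \tr ((A - B) * (A ^+ j.*2.+1 - B ^+ j.*2.+1)) =
    \sum_x \sum_y (a 0 x - b 0 y) * (a 0 x ^+ j.*2.+1 - b 0 y ^+ j.*2.+1)
       * U x y ^+ 2.
  rewrite -[X in _ * X]subT [LHS](mxtrace_orthogonal _ _ P1 Q1).
  apply: eq_bigr => x _; apply: eq_bigr => y _.
  rewrite powA powB {1}AE {1}BE !PdQ !mxE; ring.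
have -> : \tr ((A - B) * (A - B) * (A ^+ j.*2 + B ^+ j.*2)) =
    \sum_x \sum_y (a 0 x - b 0 y) ^+ 2 * (a 0 x ^+ j.*2 + b 0 y ^+ j.*2)
       * U x y ^+ 2.
  rewrite mulrDr raddfD /=.
  have -> : \tr ((A - B) * (A - B) * A ^+ j.*2) =
      \tr ((A ^+ j.*2 *m (A - B)) *m (A - B)^T).
    by rewrite [LHS]mxtrace_mulC -D1 mulmxA.
  have -> : \tr ((A - B) * (A - B) * B ^+ j.*2) =
      \tr (((A - B) *m B ^+ j.*2) *m (A - B)^T).
    by rewrite -[LHS]/(\tr ((A - B) *m (A - B) *m B ^+ j.*2)) -mulmxA mxtrace_mulC -D1.
  rewrite !(mxtrace_orthogonal _ _ P1 Q1) -big_split; apply: eq_bigr => x _.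
  rewrite -big_split; apply: eq_bigr => y _ /=.
  have -> : P *m (A ^+ j.*2 *m (A - B)) *m Q^T =
      diag_mx (\row_i a 0 i ^+ j.*2) *m (P *m (A - B) *m Q^T).
    by rewrite powA !mulmxA P1 mul1mx.
  have -> : P *m ((A - B) *m B ^+ j.*2) *m Q^T =
      (P *m (A - B) *m Q^T) *m diag_mx (\row_i b 0 i ^+ j.*2).
    by rewrite powB !mulmxA -(mulmxA _ Q) Q1 mulmx1.
  have : (P *m (A - B) *m Q^T) x y = (a 0 x - b 0 y) * U x y.
    by rewrite {1}AE {1}BE PdQ.
  move: (P *m (A - B) *m Q^T) => X XE.
  rewrite mul_diag_mx mul_mx_diag !mxE XE; ring.
rewrite mulr_sumr; apply: ler_sum => x _.
rewrite mulr_sumr; apply: ler_sum => y _.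
rewrite [leRHS]mulrA; apply: ler_wpM2r; first exact: sqr_ge0.
exact: odd_power_diff_le.
Qed.

(** The right side is visibly monotone in Y, although the product [Y * Z ^+ j.*2] need not be
    symmetric. *)
Lemma mxtrace_even_power_conj (Y Z : 'M[R]_n) j : Z^T = Z ->
  \tr (Y * Z ^+ j.*2) = \tr (Z ^+ j *m Y *m (Z ^+ j)^T).
Proof.
move=> symZ; rewrite trmxX symZ [RHS]mxtrace_mulC mulmxA -[Z ^+ j *m _]exprD.
by rewrite addnn [RHS]mxtrace_mulC.
Qed.

Lemma mxtrace_even_power_le (X Y Z : 'M[R]_n) j : Z^T = Z ->
  (forall v, qform X v <= qform Y v) ->
  \tr (X * Z ^+ j.*2) <= \tr (Y * Z ^+ j.*2).
Proof.
move=> symZ XY; rewrite -subr_ge0 -raddfB /= -mulrBl mxtrace_even_power_conj //.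
apply: mxtrace_conj_ge0 => v.
by rewrite -scaleN1r qformD qformZ mulN1r subr_ge0.
Qed.

(** This is [t <= (t ^+ 2 + 1) / 2] on the spectrum: [(Z - 1) ^+ 2 * Z ^+ j.*2] has nonnegative
    trace. *)
Lemma mxtrace_odd_power_le (Z : 'M[R]_n) j : Z^T = Z ->
  \tr (Z ^+ j.*2.+1) <= (\tr (Z ^+ j.*2.+2) + \tr (Z ^+ j.*2)) / 2.
Proof.
move=> symZ.
have : 0 <= \tr ((Z - 1) ^+ 2 * Z ^+ j.*2).
  rewrite mxtrace_even_power_conj //; apply: mxtrace_conj_ge0 => v.
  have s1 : (Z - 1)^T = Z - 1 by rewrite linearB /= symZ trmx1.
  have -> : (Z - 1) ^+ 2 = (Z - 1) *m 1%:M *m (Z - 1)^T by rewrite s1 mulmx1.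
  by rewrite qform_conj qform1 normsq_ge0.
rewrite sqrrB1 mulrDl mulrBl -exprD mulrnAl -exprS mul1r !addSn add0n.
by rewrite raddfD raddfB /= raddfMn /= => h; lra.
Qed.

Lemma qform_sqr_le (Y : 'M[R]_n) r : Y^T = Y ->
  (forall v, 0 <= qform Y v <= r * (v *m v^T) 0 0) ->
  forall v, qform (Y * Y) v <= r * qform Y v.
Proof.
move=> symY Yr v; have [P [d [P1 YE]]] := real_spectral symY.
have dr i : 0 <= d 0 i <= r.
  have := Yr (row i P).
  have rP : row i P *m P^T = delta_mx 0 i by rewrite -row_mul P1 row1.
  rewrite YE qform_conj_tr rP qform_diag -(orthogonal_normsq _ P1) rP.
  rewrite mulmx_rv_trE (bigD1 i) //= big1 => [|j ji]; last first.
    by rewrite !mxE (negPf ji) andbF expr0n mulr0.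
  rewrite [X in _ <= _ * X](bigD1 i) //= big1 => [|j ji]; last first.
    by rewrite !mxE (negPf ji) andbF mulr0.
  by rewrite !mxE !eqxx expr1n !mulr1 !addr0 mulr1.
rewrite -expr2 YE spectral_exp // !qform_conj_tr !qform_diag mulr_sumr.
apply: ler_sum => i _; rewrite mxE mulrA; apply: ler_wpM2r; first exact: sqr_ge0.
by rewrite expr2; have /andP[d0 d1] := dr i; apply: ler_wpM2r.
Qed.

(** The power is even, so the sign of Z may be changed and the negative case suffices; a Rayleigh
    quotient below [- a] forces an eigenvalue below [- a]. *)
Lemma mxtrace_even_power_ge (Z : 'M[R]_n) a k v : Z^T = Z -> 0 <= a ->
  a * (v *m v^T) 0 0 < `|qform Z v| -> a ^+ k.*2 <= \tr (Z ^+ k.*2).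
Proof.
move=> symZ a0; wlog hv : Z symZ / qform Z v < - a * (v *m v^T) 0 0 => [hw|_].
  rewrite ltr_normr => /orP[h|h]; last first.
    by apply: hw; rewrite ?lter_normr //; rewrite ?ltr_normr ?h ?orbT //; lra.
  have -> : Z ^+ k.*2 = (- Z) ^+ k.*2 by rewrite -mul2n !exprM sqrrN.
  have NZ : qform (- Z) v = - qform Z v by rewrite -scaleN1r qformZ mulN1r.
  by apply: hw; rewrite ?linearN /= ?symZ ?NZ ?normrN ?ltr_normr ?h //; lra.
have [P [d [P1 ZE]]] := real_spectral symZ.
have [i di] : exists i, d 0 i < - a.
  apply/existsP; move: hv; apply: contraLR => /existsPn h.
  rewrite -leNgt ZE qform_conj_tr qform_diag -(orthogonal_normsq v P1).
  rewrite mulmx_rv_trE mulr_sumr; apply: ler_sum => i _.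
  by rewrite -expr2; apply: ler_wpM2r; [exact: sqr_ge0 | rewrite leNgt h].
rewrite ZE spectral_exp // mxtrace_mulC mulmxA P1 mul1mx mxtrace_diag.
rewrite (bigD1 i) //= mxE -[leLHS]addr0; apply: lerD.
  rewrite -mul2n !exprM; apply: lerXn2r; rewrite ?nnegrE ?sqr_ge0 //.
  by rewrite -[leRHS]sqrrN; apply: lerXn2r; rewrite ?nnegrE //; lra.
by apply: sumr_ge0 => x _; rewrite mxE -mul2n exprM exprn_ge0 ?sqr_ge0.
Qed.

End QuadraticForms.

(** * Expectation over Bernoulli subsets *)

Lemma prod_add_set (R : comPzSemiRingType) (J : finType) (F G : J -> R) :
  \prod_i (F i + G i) =
    \sum_(S : {set J}) \prod_i (if i \in S then F i else G i).
Proof. exact: bigA_distr. Qed.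

Section Bernoulli.
Variables (R : realFieldType) (J : finType) (q : R).
Implicit Types (S : {set J}) (F G : {set J} -> R).

Definition bernoulli S : R := \prod_x (if x \in S then q else 1 - q).

Definition expect F : R := \sum_S bernoulli S * F S.

Lemma expect_cst c : expect (fun=> c) = c.
Proof.
rewrite /expect -mulr_suml /bernoulli.
rewrite -(prod_add_set (fun=> q) (fun=> 1 - q)).
by rewrite big1 ?mul1r // => i _; rewrite addrC subrK.
Qed.

Lemma eq_expect F G : F =1 G -> expect F = expect G.
Proof. by move=> FG; apply: eq_bigr => S _; rewrite FG. Qed.

Lemma expectD F G : expect (fun S => F S + G S) = expect F + expect G.
Proof. by rewrite -big_split; apply: eq_bigr => S _; rewrite mulrDr. Qed.

Lemma expectZ c F : expect (fun S => c * F S) = c * expect F.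
Proof. by rewrite mulr_sumr; apply: eq_bigr => S _; rewrite mulrCA. Qed.

Lemma expect_sum (I : finType) (F : I -> {set J} -> R) :
  expect (fun S => \sum_i F i S) = \sum_i expect (F i).
Proof.
by rewrite exchange_big; apply: eq_bigr => S _; rewrite mulr_sumr.
Qed.

Lemma sum_toggle x F :
  \sum_S F S = \sum_(S : {set J} | x \notin S) (F S + F (x |: S)).
Proof.
rewrite (bigID (fun S => x \notin S)) /= big_split /=; congr (_ + _).
rewrite (reindex_onto (fun S => x |: S) (fun S => S :\ x)) /=; last first.
  by move=> S; rewrite negbK => xS; rewrite setD1K.
apply: eq_bigl => S; rewrite negbK setU11 /=.
apply/eqP/idP => [<-|xS]; first by rewrite setD11.
by rewrite setU1K.
Qed.

(** Replacing the coordinate x by a fresh Bernoulli value preserves the law; this plays the part of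
    integration by parts in the moment method. *)
Lemma expect_resample x F :
  expect F = expect (fun S => q * F (x |: S) + (1 - q) * F (S :\ x)).
Proof.
rewrite /expect (sum_toggle x) [RHS](sum_toggle x); apply: eq_bigr => S xS.
have -> : x |: (x |: S) = x |: S by rewrite setUA setUid.
have -> : S :\ x = S.
  by apply/setDidPl; rewrite disjoint_sym disjoints1.
rewrite setU1K //.
pose u := \prod_(y | y != x) (if y \in S then q else 1 - q).
have -> : bernoulli S = (1 - q) * u.
  by rewrite /bernoulli (bigD1 x) //= (negPf xS).
have -> : bernoulli (x |: S) = q * u.
  rewrite /bernoulli (bigD1 x) //= setU11; congr (_ * _).
  by apply: eq_bigr => y yx; rewrite in_setU1 (negPf yx).
ring.
Qed.

Hypotheses (q_ge0 : 0 <= q) (q_le1 : q <= 1).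

Lemma bernoulli_ge0 S : 0 <= bernoulli S.
Proof. by apply: prodr_ge0 => x _; case: ifP; rewrite ?subr_ge0. Qed.

Lemma ler_expect F G : (forall S, F S <= G S) -> expect F <= expect G.
Proof.
by move=> FG; apply: ler_sum => S _; apply: ler_wpM2l; rewrite ?bernoulli_ge0.
Qed.

Lemma expect_ge0 F : (forall S, 0 <= F S) -> 0 <= expect F.
Proof. by move=> F0; rewrite -(expect_cst 0); apply: ler_expect. Qed.

End Bernoulli.

(** * Moments of random sums of positive semidefinite matrices *)

Section MatrixMoments.
Variables (R : realType) (J : finType) (n : nat) (q r : R).
Variable Y : J -> 'M[R]_n.
Hypotheses (q_gt0 : 0 < q) (q_le1 : q <= 1) (r_ge0 : 0 <= r).
Hypothesis Y_sym : forall x, (Y x)^T = Y x.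
Hypothesis Y_bnd : forall x v, 0 <= qform (Y x) v <= r * (v *m v^T) 0 0.
Hypothesis Y_sum : forall v, \sum_x qform (Y x) v <= (v *m v^T) 0 0.
Implicit Types (S : {set J}).

(** Each coefficient has mean zero under Bernoulli(q), so this is the deviation of the rescaled
    sampled sum from [\sum_x Y x]. *)
Definition centered_sum S : 'M[R]_n := \sum_x ((x \in S)%:R / q - 1) *: Y x.

Local Notation Z := centered_sum.

Lemma centered_sum_sym S : (Z S)^T = Z S.
Proof.
by rewrite /Z linear_sum /=; apply: eq_bigr => x _; rewrite linearZ /= Y_sym.
Qed.

Lemma centered_sum_toggle x S : Z (x |: S) - Z (S :\ x) = q^-1 *: Y x.
Proof.
rewrite /Z (bigD1 x) //= [X in _ - X](bigD1 x) //= setU11 setD11.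
rewrite [X in _ + X - _](eq_bigr (fun y => ((y \in S)%:R / q - 1) *: Y y)); last first.
  by move=> y yx; rewrite in_setU1 (negPf yx).
rewrite [X in _ - (_ + X)](eq_bigr (fun y => ((y \in S)%:R / q - 1) *: Y y)); last first.
  by move=> y yx; rewrite in_setD1 yx.
rewrite opprD addrACA subrr addr0 -scalerBl mul0r mul1r; congr (_ *: _); ring.
Qed.

Lemma mxtrace_Y_even_ge0 x S j : 0 <= \tr (Y x * Z S ^+ j.*2).
Proof.
rewrite mxtrace_even_power_conj ?centered_sum_sym //.
by apply: mxtrace_conj_ge0 => v; have /andP[] := Y_bnd x v.
Qed.

(** The two matrices differ by [q^-1 *: Y x], so the mean value inequality for traces produces
    [Y x * Y x], which [0 <= Y x <= r] reduces to [r *: Y x]. *)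
Lemma centered_odd_power_toggle x S j :
  \tr (Y x * Z (x |: S) ^+ j.*2.+1) - \tr (Y x * Z (S :\ x) ^+ j.*2.+1) <=
  j.*2.+1%:R * r / (2 * q) *
    (\tr (Y x * Z (x |: S) ^+ j.*2) + \tr (Y x * Z (S :\ x) ^+ j.*2)).
Proof.
set A := Z (x |: S); set B := Z (S :\ x).
have symA : A^T = A := centered_sum_sym _.
have symB : B^T = B := centered_sum_sym _.
have := mxtrace_odd_power_diff j symA symB.
rewrite centered_sum_toggle.
rewrite !(scale_mulmxl, scale_mulmxr) scalerA !mxtraceZ.
rewrite mulrBr mulrDr raddfB raddfD /= => h.
have q0 : q != 0 by rewrite gt_eqF.
have YY C : C^T = C -> \tr (Y x * Y x * C ^+ j.*2) <= r * \tr (Y x * C ^+ j.*2).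
  move=> symC; rewrite -mxtraceZ -scale_mulmxl; apply: mxtrace_even_power_le => // v.
  by rewrite qformZ; apply: qform_sqr_le.
have qq : 0 < q^-1 by rewrite invr_gt0.
rewrite -(ler_pM2l qq); apply: le_trans h _.
have -> : q^-1 * (j.*2.+1%:R * r / (2 * q) *
    (\tr (Y x * A ^+ j.*2) + \tr (Y x * B ^+ j.*2))) =
  j.*2.+1%:R / 2 * (q^-1 * q^-1 * (r * \tr (Y x * A ^+ j.*2) +
     r * \tr (Y x * B ^+ j.*2))) by field.
apply: ler_wpM2l; first by rewrite divr_ge0.
apply: ler_wpM2l; first by rewrite mulr_ge0 ?ltW.
by apply: lerD; apply: YY.
Qed.

Definition even_moment j := expect q (fun S => \tr (Z S ^+ j.*2)).

Lemma even_moment0 : even_moment 0 = n%:R.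
Proof.
by rewrite /even_moment -[RHS](expect_cst J q); apply: eq_expect => S; rewrite expr0 mxtrace1.
Qed.

Lemma even_moment_ge0 j : 0 <= even_moment j.
Proof.
apply: expect_ge0 => [||S]; [exact: ltW|by []|].
rewrite -[_ ^+ _]mul1r mxtrace_even_power_conj ?centered_sum_sym //.
by apply: mxtrace_conj_ge0 => v; rewrite qform1 normsq_ge0.
Qed.

(** The centred factor has mean zero in the coordinate x, so after resampling x only the difference
    of the traces with and without x remains, and toggling bounds it. *)
Lemma expect_centered_odd x j :
  expect q (fun S => ((x \in S)%:R / q - 1) * \tr (Y x * Z S ^+ j.*2.+1)) <=
  j.*2.+1%:R * r / (2 * q) *
    expect q (fun S => ((x \in S)%:R / q + 1) * \tr (Y x * Z S ^+ j.*2)).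
Proof.
have q0 : q != 0 by rewrite gt_eqF.
have c0 : 0 <= j.*2.+1%:R * r / (2 * q).
  by rewrite divr_ge0 ?mulr_ge0 // ltW.
rewrite -expectZ (expect_resample _ x) [leRHS](expect_resample _ x).
apply: ler_expect => [||S]; [exact: ltW|by []|].
rewrite setU11 setD11.
have := centered_odd_power_toggle x S j; set c := _ / (2 * q) in c0 *.
have := mxtrace_Y_even_ge0 x (x |: S) j; have := mxtrace_Y_even_ge0 x (S :\ x) j.
set hm := \tr _; set hp := \tr _; set gp := \tr _; set gm := \tr _ => hm0 hp0 h.
have -> : q * ((true%:R / q - 1) * gp) + (1 - q) * ((false%:R / q - 1) * gm) =
   (1 - q) * (gp - gm) by rewrite /=; field.
have -> : q * (c * ((true%:R / q + 1) * hp)) + (1 - q) * (c * ((false%:R / q + 1) * hm))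
  = (1 - q) * (c * (hp + hm)) + 2 * q * (c * hp) by rewrite /=; field.
apply: ler_wpDr; last by apply: ler_wpM2l; rewrite ?subr_ge0.
by apply: mulr_ge0; apply: mulr_ge0 => //; apply: ltW.
Qed.

(** The odd moment that appears is at most the mean of its even neighbours. So the new moment M' and
    the old one M satisfy [M' <= a * ((M' + M) / 2 + 2 * M)]; since [a <= 1], half of M' is absorbed
    on the left, which gives the factor 5. *)
Lemma even_moment_step j : j.*2.+1%:R * r <= 2 * q ->
  even_moment j.+1 <= 5 * (j.*2.+1%:R * r / (2 * q)) * even_moment j.
Proof.
move=> jr; set a := _ / (2 * q).
have a0 : 0 <= a by rewrite divr_ge0 ?mulr_ge0 // ltW.
have a1 : a <= 1 by rewrite ler_pdivrMr ?mul1r // mulr_gt0.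
have step : even_moment j.+1 <=
    a * expect q (fun S => \tr (Z S ^+ j.*2.+1) + 2 * \tr (Z S ^+ j.*2)).
  rewrite /even_moment doubleS.
  have -> : expect q (fun S => \tr (Z S ^+ j.*2.+2)) =
    \sum_x expect q (fun S => ((x \in S)%:R / q - 1) * \tr (Y x * Z S ^+ j.*2.+1)).
    rewrite -expect_sum; apply: eq_expect => S.
    rewrite exprS {1}/Z mulr_suml raddf_sum; apply: eq_bigr => x _.
    by rewrite /= scale_mulmxl mxtraceZ.
  apply: le_trans (ler_sum _ (fun x _ => expect_centered_odd x j)) _.
  rewrite -mulr_sumr -expect_sum; apply: ler_wpM2l => //.
  apply: ler_expect => [||S]; [exact: ltW|by []|].
  (* Writing [w + 1 = (w - 1) + 2], the first part sums to Z and the second to [2 * \sum_x Y x],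
     where the sum is at most the identity. *)
  rewrite (eq_bigr (fun x => \tr ((((x \in S)%:R / q - 1) *: Y x) * Z S ^+ j.*2)
     + 2 * \tr (Y x * Z S ^+ j.*2))); last first.
    by move=> x _; rewrite scale_mulmxl mxtraceZ; ring.
  rewrite big_split /= -raddf_sum -mulr_suml -exprS -mulr_sumr.
  apply: lerD => //; apply: ler_wpM2l => //.
  rewrite -raddf_sum -mulr_suml -[leRHS](congr1 _ (mul1r _)).
  apply: mxtrace_even_power_le; first exact: centered_sum_sym.
  by move=> v; rewrite qform_sum qform1.
move: step; rewrite expectD expectZ -/(even_moment j).
have : expect q (fun S => \tr (Z S ^+ j.*2.+1)) <= (even_moment j.+1 + even_moment j) / 2.
  rewrite /even_moment -expectD mulrC -expectZ; apply: ler_expect => [||S]; [exact: ltW|by []|].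
  by rewrite mulrC doubleS mxtrace_odd_power_le ?centered_sum_sym.
have := even_moment_ge0 j; have := even_moment_ge0 j.+1.
move: (even_moment j.+1) (even_moment j) (expect _ _) => M1 M0 E M10 M00 h1 h2.
have h3 : a * E <= a * ((M1 + M0) / 2) by apply: ler_wpM2l.
have h4 : a * M1 <= M1 by rewrite ler_piMl.
lra.
Qed.

Lemma even_moment_le k : 5 * k%:R * r <= q ->
  even_moment k <= n%:R * (5 * k%:R * r / q) ^+ k.
Proof.
move=> kr.
have b0 : 0 <= 5 * k%:R * r / q by rewrite divr_ge0 ?mulr_ge0 // ltW.
suff: forall j, (j <= k)%N -> even_moment j <= n%:R * (5 * k%:R * r / q) ^+ j by apply.
elim=> [|j IHj] jk; first by rewrite expr0 mulr1 even_moment0.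
have jk2 : j.*2.+1%:R <= 2 * k%:R :> R.
  by rewrite -natrM ler_nat mul2n ltn_double.
have jr : j.*2.+1%:R * r <= 2 * k%:R * r by apply: ler_wpM2r.
have kr0 : 0 <= k%:R * r by rewrite mulr_ge0.
apply: le_trans (even_moment_step _) _; first lra.
rewrite exprSr [leRHS]mulrA [leLHS]mulrC; apply: ler_pM.
- exact: even_moment_ge0.
- by rewrite !mulr_ge0 ?invr_ge0 ?mulr_ge0 // ltW.
- by apply: IHj; apply: ltnW.
have -> : 5 * k%:R * r / q = 5 * (2 * k%:R * r / (2 * q)).
  by field; rewrite gt_eqF.
apply: ler_wpM2l => //; apply: ler_wpM2r => //.
by rewrite invr_ge0 mulr_ge0 // ltW.
Qed.

(** Markov's inequality for the trace of [Z S ^+ k.*2], which is at least [4 ^- k] on the bad event;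
    hence 20 = 4 * 5. *)
Lemma centered_sum_tail k (bad : pred {set J}) : 5 * k%:R * r <= q ->
  (forall S, bad S -> exists v, 2^-1 * (v *m v^T) 0 0 < `|qform (Z S) v|) ->
  expect q (fun S => (bad S)%:R) <= n%:R * (20 * k%:R * r / q) ^+ k.
Proof.
move=> kr badZ.
have [a aE] : {a : R | a = 2^-1 ^+ 2} by exists (2^-1 ^+ 2).
have a0 : 0 < a by rewrite aE exprn_gt0 ?invr_gt0.
have -> : 20 * k%:R * r / q = a^-1 * (5 * k%:R * r / q).
  by rewrite aE; field; rewrite gt_eqF.
rewrite exprMn mulrCA exprVn mulrC ler_pdivlMr ?exprn_gt0 //.
apply: le_trans (even_moment_le kr).
rewrite aE -exprM mul2n.
rewrite mulrC -expectZ; apply: ler_expect => [||S]; [exact: ltW|by []|].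
case bS : (bad S); last first.
  rewrite mulr0 -[_ ^+ _]mul1r mxtrace_even_power_conj ?centered_sum_sym //.
  by apply: mxtrace_conj_ge0 => v; rewrite qform1 normsq_ge0.
have [v hv] := badZ S bS; rewrite mulr1.
by apply: mxtrace_even_power_ge hv; rewrite ?centered_sum_sym ?invr_ge0.
Qed.

End MatrixMoments.

(** * Tails relative to a reference form *)

Lemma bool_itv01 (R : realDomainType) (b : bool) : 0 <= (b%:R : R) <= 1.
Proof. by case: b; rewrite ?lexx ler01. Qed.

Lemma sum_mem_card (R : pzSemiRingType) (J : finType) (A : {set J}) :
  \sum_x (x \in A)%:R = #|A|%:R :> R.
Proof.
by rewrite -natr_sum -sum1_card [in RHS]big_mkcond; congr _%:R;
   apply: eq_bigr => x _; case: (x \in A).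
Qed.

Section RelativeConcentration.
Variables (R : realType) (J : finType) (q r : R).
Hypotheses (q_gt0 : 0 < q) (q_le1 : q <= 1) (r_ge0 : 0 <= r).

(** An isotropic vector of a positive semidefinite form lies in its kernel. This handles degenerate
    reference forms, such as Laplacians, which kill constants. *)
Lemma qform_add_isotropic n (Y : 'M[R]_n) (u v : 'rV[R]_n) : Y^T = Y ->
  (forall w, 0 <= qform Y w) -> qform Y v = 0 -> qform Y (u + v) = qform Y u.
Proof.
move=> symY Y0; have [P [d [P1 YE]]] := real_spectral symY.
have dE w : qform Y w = \sum_i d 0 i * (w *m P^T) 0 i ^+ 2.
  by rewrite YE qform_conj_tr qform_diag.
have d0 i : 0 <= d 0 i.
  have := Y0 (row i P); rewrite dE -row_mul P1 row1 (bigD1 i) //= big1 => [|j ji].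
    by rewrite mxE !eqxx expr1n mulr1 addr0.
  by rewrite mxE (negPf ji) andbF expr0n mulr0.
rewrite dE => /eqP; rewrite psumr_eq0 => [/allP h|i _]; last first.
  by rewrite mulr_ge0 ?sqr_ge0.
rewrite !dE; apply: eq_bigr => i _.
have := h i (mem_index_enum _); rewrite /= mulf_eq0 sqrf_eq0 => /orP[/eqP->|/eqP vi].
  by rewrite !mul0r.
by rewrite mulmxDl mxE vi addr0.
Qed.

(** A change of coordinates turns T into the norm. Nothing is lost on the kernel of T, because every
    [Y x] is at most [r] times T and vanishes there too. *)
Lemma qform_relative_tail n (T : 'M[R]_n) (Y : J -> 'M[R]_n) k
    (bad : pred {set J}) :
  T^T = T -> (forall x, (Y x)^T = Y x) ->
  (forall x v, 0 <= qform (Y x) v <= r * qform T v) ->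
  (forall v, \sum_x qform (Y x) v <= qform T v) ->
  5 * k%:R * r <= q ->
  (forall S, bad S -> exists v,
     2^-1 * qform T v < \sum_x (1 - (x \in S)%:R / q) * qform (Y x) v) ->
  expect q (fun S => (bad S)%:R) <= n%:R * (20 * k%:R * r / q) ^+ k.
Proof.
move=> symT symY Yr Ysum kr hbad.
have [P [t [P1 TE]]] := real_spectral symT.
have tE w : qform T w = \sum_i t 0 i * (w *m P^T) 0 i ^+ 2.
  by rewrite TE qform_conj_tr qform_diag.
have t0 i : 0 <= t 0 i.
  have : 0 <= qform T (row i P).
    by apply: le_trans (Ysum _); apply: sumr_ge0 => x _; have /andP[] := Yr x (row i P).
  rewrite tE -row_mul P1 row1 (bigD1 i) //= big1 => [|j ji].
    by rewrite mxE !eqxx expr1n mulr1 addr0.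
  by rewrite mxE (negPf ji) andbF expr0n mulr0.
pose s i := Num.sqrt (t 0 i).
have ss i : s i ^+ 2 = t 0 i by rewrite sqr_sqrtr.
(* Where t vanishes the inverse is 0, so M is a pseudo-inverse square root
   of T. *)
have [M ME] : {M | M = diag_mx (\row_i (s i)^-1) *m P}.
  by exists (diag_mx (\row_i (s i)^-1) *m P).
have MP w : w *m M *m P^T = \row_i (w 0 i * (s i)^-1).
  by rewrite ME mulmxA -mulmxA P1 mulmx1 mul_mx_diag; apply/rowP => i; rewrite !mxE.
have TM w : qform T (w *m M) <= (w *m w^T) 0 0.
  rewrite tE MP mulmx_rv_trE; apply: ler_sum => i _; rewrite mxE exprMn -ss.
  have [->|s0] := eqVneq (s i) 0; first by rewrite expr0n mul0r -expr2 sqr_ge0.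
  by rewrite mulrCA exprVn mulfV ?expf_neq0 // mulr1 expr2.
apply: (@centered_sum_tail R J n q r (fun x => M *m Y x *m M^T)) => //.
- by move=> x; rewrite !trmx_mul trmxK symY mulmxA.
- move=> x w; rewrite qform_conj; have /andP[-> h] /= := Yr x (w *m M).
  by apply: le_trans h _; apply: ler_wpM2l.
- move=> w; apply: le_trans (TM w); apply: le_trans (Ysum _).
  by apply: ler_sum => x _; rewrite qform_conj.
move=> S /hbad[v hv].
(* These are the coordinates of v in which T is the norm; [v - w *m M] lies in the kernel of T. *)
pose w := \row_i ((v *m P^T) 0 i * s i).
have ww : (w *m w^T) 0 0 = qform T v.
  rewrite tE mulmx_rv_trE; apply: eq_bigr => i _; rewrite -ss !mxE; ring.
exists w; rewrite ww qform_sum.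
have YM x : qform (M *m Y x *m M^T) w = qform (Y x) v.
  rewrite qform_conj -[v](subrK (w *m M)) addrC [RHS]qform_add_isotropic //.
    by move=> u; have /andP[] := Yr x u.
  apply: le_anti; have /andP[-> h] := Yr x (v - w *m M); rewrite andbT.
  apply: (le_trans h); rewrite tE big1 ?mulr0 // => i _.
  have rB (A B : 'rV[R]_n) : (A - B) 0 i = A 0 i - B 0 i by rewrite !mxE.
  have wi : w 0 i = (v *m P^T) 0 i * s i by rewrite mxE.
  rewrite mulmxBl MP -ss rB [X in _ - X]mxE wi.
  have [->|s0] := eqVneq (s i) 0; first by rewrite expr0n mul0r.
  by rewrite mulfK // subrr expr0n mulr0.
rewrite (eq_bigr (fun x => - ((1 - (x \in S)%:R / q) * qform (Y x) v))); last first.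
  by move=> x _; rewrite qformZ YM; ring.
by rewrite sumrN normrN (lt_le_trans hv) // ler_norm.
Qed.

(** The case of dimension one, with [Y x] equal to [1 / #|A|] on A and 0 elsewhere, and
    [r = 1 / #|A|]; it stands in for a Chernoff bound. *)
Lemma card_bernoulli_tail (A : {set J}) k : 5 * k%:R <= q * #|A|%:R -> (0 < #|A|)%N ->
  expect q (fun S => (~~ (#|A|%:R / 2 <= #|A :&: S|%:R / q <= 3 / 2 * #|A|%:R))%:R)
    <= (20 * k%:R / (q * #|A|%:R)) ^+ k.
Proof.
move=> kq A0; have a0 : 0 < #|A|%:R :> R by rewrite ltr0n.
have q0 : q != 0 by rewrite gt_eqF.
have an0 : #|A|%:R != 0 :> R by rewrite gt_eqF.
pose a (x : J) : R := (x \in A)%:R / #|A|%:R.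
have a_ge x : 0 <= a x by rewrite divr_ge0.
have suma : \sum_x a x = 1.
  by rewrite -mulr_suml sum_mem_card mulfV.
have qf x (v : 'rV[R]_1) : qform (a x)%:M v = a x * (v *m v^T) 0 0.
  by rewrite -scalemx1 qformZ qform1.
have -> : (20 * k%:R / (q * #|A|%:R)) ^+ k =
    1%:R * (20 * k%:R * #|A|%:R^-1 / q) ^+ k.
  by rewrite mul1r; congr (_ ^+ _); field; rewrite q0 an0.
apply: (@centered_sum_tail R J 1 q (#|A|%:R^-1) (fun x => (a x)%:M)) => //.
- by rewrite invr_ge0 ltW.
- by move=> x; rewrite tr_scalar_mx.
- move=> x v; rewrite qf mulr_ge0 ?normsq_ge0 //=.
  rewrite ler_wpM2r ?normsq_ge0 // /a; apply: ler_piMl; first by rewrite invr_ge0 ltW.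
  by have /andP[] := bool_itv01 R (x \in A).
- by move=> v; under eq_bigr do rewrite qf; rewrite -mulr_suml suma mul1r.
- by rewrite ler_pdivrMr.
move=> S hS; exists 1%:M; rewrite qform_sum.
have -> : (1%:M *m (1%:M : 'M[R]_1)^T) 0 0 = 1 by rewrite trmx1 mulmx1 mxE eqxx.
rewrite (eq_bigr (fun x => (x \in A :&: S)%:R / (q * #|A|%:R) - a x)); last first.
  move=> x _; rewrite qformZ qf trmx1 mulmx1 mxE eqxx mulr1 /a in_setI.
  by case: (x \in A); case: (x \in S) => /=; field; rewrite q0 an0.
rewrite sumrB suma -mulr_suml sum_mem_card.
move: hS; rewrite negb_and -!ltNge mulr1 ltr_normr => /orP[h|h]; apply/orP.
  right; move: h; rewrite ltr_pdivrMr // => h.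
  rewrite opprB ltrBrDr -ltrBrDl ltr_pdivrMr ?mulr_gt0 //; lra.
left; move: h; rewrite ltr_pdivlMr // => h.
rewrite ltrBrDr ltr_pdivlMr ?mulr_gt0 //; lra.
Qed.

End RelativeConcentration.

(** * Weighted Laplacian forms and elimination of an independent side *)

Section LaplacianForms.
Variables (R : realType) (U : finType).
Implicit Types (c : U -> U -> R) (g : U -> R).

Definition lapform c g : R := \sum_y \sum_z c y z * (g y - g z) ^+ 2.

(** The factors 2 match [lapform], whose sum runs over ordered pairs. Loops cancel here as they do
    there, so kernels with a nonzero diagonal, such as cliques [a y * a z], are allowed. *)
Definition lapmx c : 'M[R]_#|U| :=
  \matrix_(i, j) ((i == j)%:R * (2 * \sum_z c (enum_val i) z)
                  - 2 * c (enum_val i) (enum_val j)).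

Definition funrow g : 'rV[R]_#|U| := \row_i g (enum_val i).

Lemma sum_enum_val (F : U -> R) : \sum_(i < #|U|) F (enum_val i) = \sum_y F y.
Proof. by rewrite -(big_enum_val F); apply: eq_bigl. Qed.

Lemma funrowE (v : 'rV[R]_#|U|) : funrow (fun y => v 0 (enum_rank y)) = v.
Proof. by apply/rowP => i; rewrite mxE enum_valK. Qed.

Lemma lapformE c g : (forall y z, c y z = c z y) ->
  lapform c g = 2 * \sum_y (\sum_z c y z) * g y ^+ 2
                - 2 * \sum_y \sum_z c y z * g y * g z.
Proof.
move=> symc; rewrite /lapform.
have -> : 2 * \sum_y (\sum_z c y z) * g y ^+ 2 =
    \sum_y \sum_z c y z * g y ^+ 2 + \sum_y \sum_z c y z * g z ^+ 2.
  rewrite [X in _ + X]exchange_big /= mulr_natl mulr2n; congr (_ + _).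
    by apply: eq_bigr => y _; rewrite mulr_suml.
  apply: eq_bigr => y _; rewrite mulr_suml; apply: eq_bigr => z _.
  by rewrite symc.
rewrite mulr_sumr -!big_split -sumrB; apply: eq_bigr => y _ /=.
rewrite mulr_sumr -!big_split -sumrB; apply: eq_bigr => z _ /=.
ring.
Qed.

Lemma lapmx_sym c : (forall y z, c y z = c z y) -> (lapmx c)^T = lapmx c.
Proof.
move=> symc; apply/matrixP => i j; rewrite !mxE symc eq_sym.
by have [->|] := eqVneq i j; rewrite ?mul0r.
Qed.

Lemma qform_lapmx c g : (forall y z, c y z = c z y) ->
  qform (lapmx c) (funrow g) = lapform c g.
Proof.
move=> symc; rewrite qformE lapformE // -sum_enum_val -[X in _ - 2 * X]sum_enum_val.
rewrite !mulr_sumr -sumrB; apply: eq_bigr => i _.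
rewrite (eq_bigr (fun j =>
   g (enum_val i) * ((i == j)%:R * (2 * \sum_z c (enum_val i) z)) * g (enum_val j)
   - 2 * (c (enum_val i) (enum_val j) * g (enum_val i) * g (enum_val j)))); last first.
  by move=> j _; rewrite !mxE; ring.
rewrite sumrB -mulr_sumr; congr (_ - _ * _); last first.
  exact: (sum_enum_val (fun z => c (enum_val i) z * g (enum_val i) * g z)).
move: (\sum_z c (enum_val i) z) => B.
rewrite (bigD1 i) //= big1 => [|j ji]; last by rewrite eq_sym (negPf ji) mul0r mulr0 mul0r.
by rewrite eqxx mul1r addr0 expr2; ring.
Qed.

Lemma lapform_tail (J : finType) (q r : R) (T : U -> U -> R)
    (c : J -> U -> U -> R) k (bad : pred {set J}) :
  0 < q -> q <= 1 -> 0 <= r ->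
  (forall y z, T y z = T z y) -> (forall x y z, c x y z = c x z y) ->
  (forall x g, 0 <= lapform (c x) g <= r * lapform T g) ->
  (forall g, \sum_x lapform (c x) g <= lapform T g) ->
  5 * k%:R * r <= q ->
  (forall S, bad S -> exists g,
     2^-1 * lapform T g < \sum_x (1 - (x \in S)%:R / q) * lapform (c x) g) ->
  expect q (fun S => (bad S)%:R) <= #|U|%:R * (20 * k%:R * r / q) ^+ k.
Proof.
move=> q0 q1 r0 symT symc cr csum kr hbad.
apply: (@qform_relative_tail R J q r q0 q1 r0 _ (lapmx T) (fun x => lapmx (c x))) => //.
- exact: lapmx_sym.
- by move=> x; apply: lapmx_sym.
- by move=> x v; rewrite -[v]funrowE !qform_lapmx.
- move=> v; rewrite -[v]funrowE qform_lapmx //.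
  by under eq_bigr do rewrite qform_lapmx //.
move=> S /hbad[g hg]; exists (funrow g); rewrite qform_lapmx //.
by under eq_bigr do rewrite qform_lapmx //.
Qed.

Lemma lapform_ge0 c g : (forall y z, 0 <= c y z) -> 0 <= lapform c g.
Proof.
move=> c0; apply: sumr_ge0 => y _; apply: sumr_ge0 => z _.
by rewrite mulr_ge0 ?sqr_ge0.
Qed.

Lemma lapformD c c' g :
  lapform (fun y z => c y z + c' y z) g = lapform c g + lapform c' g.
Proof.
rewrite -big_split; apply: eq_bigr => y _; rewrite -big_split.
by apply: eq_bigr => z _; rewrite mulrDl.
Qed.

Lemma lapform_sum (J : finType) (c : J -> U -> U -> R) g :
  lapform (fun y z => \sum_x c x y z) g = \sum_x lapform (c x) g.
Proof.
rewrite exchange_big; apply: eq_bigr => y _; rewrite exchange_big.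
by apply: eq_bigr => z _; rewrite mulr_suml.
Qed.

End LaplacianForms.

(* Minimising over the values h x decouples the vertices of the side J: the
   Schur complement of the star at x is the clique with weights
   a x y * a x z / D x. *)
Section StarElimination.
Variables (R : realType) (U J : finType).
Variables (b : U -> U -> R) (a : J -> U -> R) (mu : U -> R) (nu : J -> R).
Hypotheses (b_ge0 : forall y z, 0 <= b y z) (a_ge0 : forall x y, 0 <= a x y).
Hypotheses (mu_ge0 : forall y, 0 <= mu y) (nu_ge0 : forall x, 0 <= nu x).

Definition star_deg x : R := \sum_y a x y.
Definition star_clique x y z : R := a x y * a x z / star_deg x.
Definition schur_kernel y z : R := b y z + \sum_x star_clique x y z.

(** The factor 2 counts star edges in both orientations, as [lapform] does for b. *)
Definition star_energy (m : J -> R) g h : R :=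
  lapform b g + 2 * \sum_x m x * \sum_y a x y * (h x - g y) ^+ 2.

(** An arbitrary shift t replaces the weighted mean, so that a gap passes from one measure to
    another with the same t. *)
Definition star_gap lam (m : J -> R) := forall g h, exists t,
  lam * (\sum_y mu y * (g y - t) ^+ 2 + \sum_x m x * nu x * (h x - t) ^+ 2)
    <= star_energy m g h.

Lemma star_deg_ge0 x : 0 <= star_deg x.
Proof. exact: sumr_ge0. Qed.

Lemma star_clique_ge0 x y z : 0 <= star_clique x y z.
Proof. by rewrite /star_clique divr_ge0 ?mulr_ge0 ?star_deg_ge0. Qed.

Lemma star_clique_sym x y z : star_clique x y z = star_clique x z y.
Proof. by rewrite /star_clique (mulrC (a x y)). Qed.

Lemma star_clique_form x g t : star_deg x != 0 ->
  2 * (\sum_y a x y * (t - g y) ^+ 2) =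
    lapform (star_clique x) g
    + 2 / star_deg x * (star_deg x * t - \sum_y a x y * g y) ^+ 2.
Proof.
move=> D0; rewrite lapformE; last exact: star_clique_sym.
set D := star_deg x in D0 *.
have -> : \sum_y (\sum_z star_clique x y z) * g y ^+ 2 = \sum_y a x y * g y ^+ 2.
  apply: eq_bigr => y _; congr (_ * _).
  rewrite /star_clique -/D -mulr_suml -mulr_sumr -/(star_deg x) -/D.
  by rewrite -mulrA mulfV ?mulr1.
have -> : \sum_y \sum_z star_clique x y z * g y * g z =
    (\sum_y a x y * g y) ^+ 2 / D.
  rewrite expr2 mulr_suml mulr_suml; apply: eq_bigr => y _.
  rewrite mulr_sumr mulr_suml; apply: eq_bigr => z _.
  by rewrite /star_clique -/D; ring.
have -> : \sum_y a x y * (t - g y) ^+ 2 =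
    D * t ^+ 2 - 2 * t * (\sum_y a x y * g y) + \sum_y a x y * g y ^+ 2.
  rewrite /D /star_deg mulr_suml mulr_sumr -sumrB -big_split.
  by apply: eq_bigr => y _ /=; ring.
by field.
Qed.

Lemma star_deg_eq0 x : star_deg x = 0 -> forall y, a x y = 0.
Proof.
move=> /eqP; rewrite psumr_eq0 // => /allP h y.
by apply/eqP; have := h y (mem_index_enum _).
Qed.

Lemma star_clique_le x g t :
  lapform (star_clique x) g <= 2 * (\sum_y a x y * (t - g y) ^+ 2).
Proof.
(* An isolated x contributes nothing on either side: its clique is 0 because division by 0 yields
   0. *)
have [D0|D0] := eqVneq (star_deg x) 0.
  rewrite /lapform big1 => [|y _]; last first.
    by rewrite big1 // => z _; rewrite /star_clique D0 invr0 mulr0 mul0r.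
  by rewrite big1 ?mulr0 // => y _; rewrite star_deg_eq0 ?mul0r.
rewrite star_clique_form // lerDl mulr_ge0 ?sqr_ge0 //.
by rewrite divr_ge0 ?star_deg_ge0.
Qed.

Lemma star_clique_min x g : exists t,
  lapform (star_clique x) g = 2 * (\sum_y a x y * (t - g y) ^+ 2).
Proof.
have [D0|D0] := eqVneq (star_deg x) 0.
  exists 0; rewrite /lapform big1 => [|y _]; last first.
    by rewrite big1 // => z _; rewrite /star_clique D0 invr0 mulr0 mul0r.
  by rewrite big1 ?mulr0 // => y _; rewrite star_deg_eq0 ?mul0r.
exists ((\sum_y a x y * g y) / star_deg x).
rewrite star_clique_form // [star_deg x * (_ / _)]mulrCA mulfV // mulr1 subrr expr0n mulr0 addr0.
by [].
Qed.

Lemma schur_kernel_form g :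
  lapform schur_kernel g = lapform b g + \sum_x lapform (star_clique x) g.
Proof. by rewrite lapformD lapform_sum. Qed.

(** The gap is applied with h minimising at every x, where the energy equals the Schur form; the
    mass of the side J is then dropped. *)
Lemma schur_gap lam : 0 <= lam -> star_gap lam (fun=> 1) ->
  forall g, exists t, lam * (\sum_y mu y * (g y - t) ^+ 2) <= lapform schur_kernel g.
Proof.
move=> lam0 gap g.
have /fin_all_exists[h hE] := star_clique_min ^~ g.
have [t ht] := gap g h; exists t.
have -> : lapform schur_kernel g = star_energy (fun=> 1) g h.
  rewrite schur_kernel_form /star_energy mulr_sumr; congr (_ + _).
  by apply: eq_bigr => x _; rewrite hE mul1r.
apply: le_trans ht; apply: ler_wpM2l => //; rewrite lerDl.
by apply: sumr_ge0 => x _; rewrite mul1r mulr_ge0 ?sqr_ge0.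
Qed.

(** A clique is at most twice its star centred at t, hence at most [2 / dm] times the mass of
    [g - t], which the gap bounds by the whole form. This supplies the parameter r of the tail
    bound. *)
Lemma star_clique_rel lam dm x g : 0 < lam -> 0 < dm ->
  star_gap lam (fun=> 1) -> (forall y, dm * a x y <= mu y) ->
  0 <= lapform (star_clique x) g <= 2 / (lam * dm) * lapform schur_kernel g.
Proof.
move=> lam0 dm0 gap da; rewrite lapform_ge0; last exact: star_clique_ge0.
have [t ht] := schur_gap (ltW lam0) gap g.
apply: le_trans (star_clique_le x g t) _ => /=.
rewrite -mulrA; apply: ler_wpM2l => //.
rewrite mulrC ler_pdivlMr ?mulr_gt0 //; apply: le_trans ht.
rewrite mulrC -mulrA; apply: ler_wpM2l; first exact: ltW.
rewrite mulr_sumr; apply: ler_sum => y _.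
by rewrite mulrA -(sqrrN (t - g y)) opprB; apply: ler_wpM2r; rewrite ?sqr_ge0.
Qed.

(** With M and N the masses of the two sides, concentration and the Schur gap give
    [lam * M <= 2 * E], and comparing h at x with g at its neighbours gives [N <= E + 4 * M].
    Together [lam * (M + N) <= (2 + 1 + 8) * E], whence 11. *)
Lemma star_gap_sampled lam (m : J -> R) : 0 < lam -> lam <= 1 ->
  (forall x, 0 <= m x) -> star_gap lam (fun=> 1) ->
  (forall g, \sum_x (1 - m x) * lapform (star_clique x) g
      <= 2^-1 * lapform schur_kernel g) ->
  (forall x, nu x <= star_deg x) ->
  (forall y, \sum_x m x * a x y <= 2 * mu y) ->
  star_gap (lam / 11) m.
Proof.
move=> lam0 lam1 m0 gap conc nuD mD g h.
have [t ht] := schur_gap (ltW lam0) gap g; exists t.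
set E := star_energy m g h; set M := \sum_y _ in ht *; set N := \sum_x _.
have M0 : 0 <= M by apply: sumr_ge0 => y _; rewrite mulr_ge0 ?sqr_ge0.
have bE : lapform b g <= E.
  rewrite lerDl mulr_ge0 //; apply: sumr_ge0 => x _; rewrite mulr_ge0 //.
  by apply: sumr_ge0 => y _; rewrite mulr_ge0 ?sqr_ge0.
have ET : lapform schur_kernel g / 2 <= E.
  have : lapform b g + \sum_x m x * lapform (star_clique x) g <= E.
    rewrite lerD2l mulr_sumr; apply: ler_sum => x _.
    by rewrite mulrCA; apply: ler_wpM2l => //; apply: star_clique_le.
  have := conc g; rewrite (eq_bigr (fun x => lapform (star_clique x) g -
     m x * lapform (star_clique x) g)); last by move=> x _; ring.
  rewrite sumrB; have := schur_kernel_form g; lra.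
have NE : N <= E + 4 * M.
  have b0 := lapform_ge0 g b_ge0.
  have : N <= \sum_x m x * \sum_y a x y * (2 * (h x - g y) ^+ 2 + 2 * (g y - t) ^+ 2).
    apply: ler_sum => x _; rewrite -mulrA; apply: ler_wpM2l => //.
    apply: (@le_trans _ _ (star_deg x * (h x - t) ^+ 2)).
      by apply: ler_wpM2r; rewrite ?sqr_ge0.
    rewrite /star_deg mulr_suml; apply: ler_sum => y _; apply: ler_wpM2l => //.
    by have := sqr_ge0 ((h x - g y) - (g y - t)); lra.
  move/le_trans; apply.
  have -> : \sum_x m x * \sum_y a x y * (2 * (h x - g y) ^+ 2 + 2 * (g y - t) ^+ 2) =
    2 * (\sum_x m x * \sum_y a x y * (h x - g y) ^+ 2) +
    \sum_y (\sum_x m x * a x y) * (2 * (g y - t) ^+ 2).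
    have -> : \sum_y (\sum_x m x * a x y) * (2 * (g y - t) ^+ 2) =
        \sum_x m x * \sum_y a x y * (2 * (g y - t) ^+ 2).
      rewrite (eq_bigr (fun y => \sum_x m x * (a x y * (2 * (g y - t) ^+ 2)))); last first.
        by move=> y _; rewrite mulr_suml; apply: eq_bigr => x _; rewrite mulrA.
      by rewrite exchange_big; apply: eq_bigr => x _; rewrite mulr_sumr.
    rewrite mulr_sumr -big_split; apply: eq_bigr => x _ /=.
    rewrite [2 * (m x * _)]mulrCA -mulrDr; congr (_ * _).
    rewrite mulr_sumr -big_split.
    by apply: eq_bigr => y _ /=; ring.
  apply: lerD; first by rewrite lerDr.
  rewrite mulr_sumr; apply: ler_sum => y _.
  apply: le_trans (ler_wpM2r _ (mD y)) _; first by rewrite mulr_ge0 ?sqr_ge0.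
  by rewrite le_eqVlt; apply/orP; left; apply/eqP; ring.
have h1 : lam * N <= lam * (E + 4 * M) by apply: ler_wpM2l; rewrite // ltW.
have E0 : 0 <= E by apply: le_trans bE; apply: lapform_ge0.
have h2 : lam * E <= E by rewrite ler_piMl.
rewrite mulrAC ler_pdivrMr //; lra.
Qed.

End StarElimination.

(** * The triple cover and the thinning of one layer *)

Section TripartiteGap.
Variables (R : realType) (V : finType) (e : rel V).
Hypothesis e_sym : symmetric e.
Implicit Types (m f g : V -> R) (S : {set V}).

Local Notation d u := ((degree e u)%:R : R).

Definition cross m m' f f' : R :=
  \sum_u \sum_v (e u v)%:R * (m u * m' v) * (f u - f' v) ^+ 2.

Definition mass m f t : R := \sum_u d u * m u * (f u - t) ^+ 2.

(** Weight [fun=> 1] is a full layer, and [sampled q S] a thinned one, rescaled so that weighted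
    degrees are unbiased. The masses refer to the degrees in G throughout. *)
Definition tri_gap lam m1 m2 m3 := forall f1 f2 f3, exists t,
  lam * (mass m1 f1 t + mass m2 f2 t + mass m3 f3 t)
    <= cross m1 m2 f1 f2 + cross m2 m3 f2 f3 + cross m3 m1 f3 f1.

Definition weighted_degree m u : R := \sum_v (e u v)%:R * m v.

(** Two such layers together give each vertex weight at least [d u], the lower bound on [star_deg]
    required when the third layer is thinned; 3/2 lies within the factor 2 allowed there. *)
Definition degree_ok m :=
  forall u, d u / 2 <= weighted_degree m u <= 3 / 2 * d u.

Definition sampled (q : R) S : V -> R := fun u => (u \in S)%:R / q.

Lemma degreeE u : d u = \sum_v (e u v)%:R.
Proof.
by rewrite /degree -sum_mem_card; apply: eq_bigr => v _; rewrite inE.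
Qed.

Lemma crossC m m' f f' : cross m m' f f' = cross m' m f' f.
Proof.
rewrite /cross exchange_big; apply: eq_bigr => u _; apply: eq_bigr => v _.
by rewrite e_sym (mulrC (m v)) -(sqrrN (f v - _)) opprB.
Qed.

(** Brings the next full layer to the third place, where the thinning happens. *)
Lemma tri_gap_rotate lam m1 m2 m3 : tri_gap lam m1 m2 m3 -> tri_gap lam m2 m3 m1.
Proof.
move=> gap f1 f2 f3; have [t ht] := gap f3 f1 f2; exists t.
by rewrite addrC addrA [leRHS]addrC addrA.
Qed.

Lemma degree_ok1 : degree_ok (fun=> 1).
Proof.
move=> u; rewrite /weighted_degree; under eq_bigr do rewrite mulr1.
by rewrite -degreeE; have := ler0n R (degree e u); lra.
Qed.

(* Splitting f_i = F + g_i with F the average turns the triple cover into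
   six copies of the form of F plus a positive definite form in the g_i. *)
Lemma tri_gap_init zeta : 0 < zeta -> zeta <= 1 ->
  (forall f, exists t, zeta * (\sum_u d u * (f u - t) ^+ 2)
     <= 2^-1 * \sum_u \sum_v (e u v)%:R * (f u - f v) ^+ 2) ->
  tri_gap (zeta / 2) (fun=> 1) (fun=> 1) (fun=> 1).
Proof.
move=> z0 z1 gap f1 f2 f3.
pose F u := (f1 u + f2 u + f3 u) / 3.
have [t ht] := gap F; exists t.
pose G u := (f1 u - F u) ^+ 2 + (f2 u - F u) ^+ 2 + (f3 u - F u) ^+ 2.
set A := \sum_u d u * _ in ht.
set B := \sum_u \sum_v _ in ht.
pose C := \sum_u d u * G u.
have C0 : 0 <= C by apply: sumr_ge0 => u _; rewrite mulr_ge0 // !addr_ge0 ?sqr_ge0.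
have massE : mass (fun=> 1) f1 t + mass (fun=> 1) f2 t + mass (fun=> 1) f3 t
    = 3 * A + C.
  rewrite /mass /A /C mulr_sumr -!big_split; apply: eq_bigr => u _ /=.
  by rewrite /G /F; field.
set Q := cross _ _ _ _ + _ + _.
have QE : 2 * Q = \sum_u \sum_v (e u v)%:R *
   ((f1 u - f2 v) ^+ 2 + (f2 u - f3 v) ^+ 2 + (f3 u - f1 v) ^+ 2
    + ((f2 u - f1 v) ^+ 2 + (f3 u - f2 v) ^+ 2 + (f1 u - f3 v) ^+ 2)).
  rewrite mulr_natl mulr2n {2}/Q (crossC _ _ f1 f2) (crossC _ _ f2 f3) (crossC _ _ f3 f1).
  rewrite /Q /cross -!big_split; apply: eq_bigr => u _ /=.
  rewrite -!big_split; apply: eq_bigr => v _ /=; ring.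
have CE : \sum_u \sum_v (e u v)%:R * (G u + G v) = 2 * C.
  have -> : \sum_u \sum_v (e u v)%:R * (G u + G v) =
      \sum_u \sum_v (e u v)%:R * G u + \sum_u \sum_v (e u v)%:R * G v.
    rewrite -big_split; apply: eq_bigr => u _; rewrite -big_split.
    by apply: eq_bigr => v _; rewrite mulrDr.
  rewrite [X in _ + X]exchange_big mulr_natl mulr2n; congr (_ + _).
    by apply: eq_bigr => u _; rewrite degreeE mulr_suml.
  apply: eq_bigr => u _; rewrite degreeE mulr_suml; apply: eq_bigr => v _.
  by rewrite e_sym.
have : 6 * B + 2 * C <= 2 * Q.
  rewrite QE -CE /B mulr_sumr -big_split; apply: ler_sum => u _ /=.
  rewrite mulr_sumr -big_split; apply: ler_sum => v _ /=.
  rewrite mulrCA -mulrDr; apply: ler_wpM2l => //.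
  rewrite -subr_ge0.
  set X := (X in 0 <= X).
  have -> : X = (f1 u - F u + (f1 v - F v)) ^+ 2 + (f2 u - F u + (f2 v - F v)) ^+ 2
     + (f3 u - F u + (f3 v - F v)) ^+ 2 by rewrite /X /G /F; field.
  by rewrite !addr_ge0 ?sqr_ge0.
rewrite massE.
have : zeta * C <= C by rewrite ler_piMl.
have A0 : 0 <= zeta * A.
  by rewrite mulr_ge0 ?(ltW z0) //; apply: sumr_ge0 => u _; rewrite mulr_ge0 ?sqr_ge0.
have : 0 <= zeta * C by rewrite mulr_ge0 // ltW.
rewrite -/Q; lra.
Qed.

Section Step.
Variables (lam dm q : R) (m1 m2 : V -> R) (k : nat).
Hypotheses (lam_gt0 : 0 < lam) (lam_le : lam <= 1 / 2) (dm_gt0 : 0 < dm).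
Hypotheses (dm_le : forall u, dm <= d u) (q_gt0 : 0 < q) (q_le1 : q <= 1).
Hypotheses (m1_ge0 : forall u, 0 <= m1 u) (m2_ge0 : forall u, 0 <= m2 u).
Hypotheses (m1_ok : degree_ok m1) (m2_ok : degree_ok m2).
Hypothesis gap : tri_gap lam m1 m2 (fun=> 1).
Hypothesis k_small : 5 * k%:R * (1 / (lam * dm)) <= q.

(** U consists of the two fixed layers; the third layer is the independent side to be eliminated. *)
Let U : finType := (V + V)%type.

Let b (y z : U) : R :=
  match y, z with
  | inl u, inr v => (e u v)%:R * (m1 u * m2 v)
  | inr u, inl v => (e u v)%:R * (m2 u * m1 v)
  | _, _ => 0
  end.

Let a (x : V) (y : U) : R :=
  match y with
  | inl u => (e x u)%:R * m1 u
  | inr u => (e x u)%:R * m2 u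
  end.

Let mu (y : U) : R :=
  match y with inl u => d u * m1 u | inr u => d u * m2 u end.

Let star_energy_tri m (g : U -> R) h :
  star_energy b a m g h = 2 * (cross m1 m2 (g \o inl) (g \o inr)
     + cross m2 m (g \o inr) h + cross m m1 h (g \o inl)).
Proof.
rewrite /star_energy mulrDr mulrDr -addrA; congr (_ + _).
  rewrite /lapform big_sumType /= mulr_natl mulr2n; congr (_ + _).
    apply: eq_bigr => u _; rewrite big_sumType /= big1 ?add0r // => v _.
    by rewrite mul0r.
  rewrite crossC; apply: eq_bigr => u _; rewrite big_sumType /= [X in _ + X]big1 ?addr0 // => v _.
  by rewrite mul0r.
rewrite -mulrDr; congr (_ * _); rewrite (crossC m2) addrC /cross -big_split.
apply: eq_bigr => x _ /=; rewrite big_sumType /= mulrDr !mulr_sumr.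
by congr (_ + _); apply: eq_bigr => u _; ring.
Qed.

(** The constant doubles because [star_energy] counts every edge twice. *)
Let star_gap_tri m lam' : tri_gap lam' m1 m2 m <->
  star_gap b a mu (fun u => d u) (2 * lam') m.
Proof.
have massE (g : U -> R) h t : \sum_y mu y * (g y - t) ^+ 2 + \sum_x m x * d x * (h x - t) ^+ 2
    = mass m1 (g \o inl) t + mass m2 (g \o inr) t + mass m h t.
  rewrite big_sumType /=; congr (_ + _).
  by apply: eq_bigr => u _; rewrite (mulrC (m u)).
split=> [H g h | H f1 f2 f3].
  have [t ht] := H (g \o inl) (g \o inr) h; exists t.
  rewrite massE star_energy_tri; lra.
pose g (y : U) := match y with inl u => f1 u | inr u => f2 u end.
have [t ht] := H g f3; exists t; move: ht.
rewrite massE star_energy_tri -mulrA ler_pM2l //.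
Qed.

Let b_ge0 y z : 0 <= b y z.
Proof. by case: y z => [u|u] [v|v] //=; rewrite !mulr_ge0. Qed.

Let a_ge0 x y : 0 <= a x y.
Proof. by case: y => u /=; rewrite mulr_ge0. Qed.

Let mu_ge0 y : 0 <= mu y.
Proof. by case: y => u /=; rewrite mulr_ge0. Qed.

Let star_degE x : star_deg a x = weighted_degree m1 x + weighted_degree m2 x.
Proof. by rewrite /star_deg big_sumType. Qed.

Let b_sym y z : b y z = b z y.
Proof. by case: y z => [u|u] [v|v] //=; rewrite e_sym (mulrC (_ u)). Qed.

(** When the sampled degrees are right, the gap can fail only if the sampled cliques fail to
    concentrate. The factor [2 * #|V|] is the dimension of the function space on the two fixed
    layers. *)
Lemma tri_step_tail :
  expect q (fun S => `[< degree_ok (sampled q S) /\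
                        ~ tri_gap (lam / 11) m1 m2 (sampled q S) >]%:R)
    <= (2 * #|V|)%:R * (20 * k%:R * (1 / (lam * dm)) / q) ^+ k.
Proof.
have cardU : #|U| = (2 * #|V|)%N by rewrite card_sum mul2n addnn.
have gap' : star_gap b a mu (fun u => d u) (2 * lam) (fun=> 1) by apply/star_gap_tri.
have lam2 : 0 < 2 * lam by rewrite mulr_gt0.
have da x y : dm * a x y <= mu y.
  case: y => u /=; rewrite mulrA; apply: ler_wpM2r => //;
    rewrite -[leRHS]mulr1; apply: ler_pM => //; rewrite ?(ltW dm_gt0) //;
    by case: (e x u).
have rE : 2 / (2 * lam * dm) = 1 / (lam * dm).
  by field; rewrite !gt_eqF.
rewrite -cardU; apply: (@lapform_tail R U V q _ (schur_kernel b a) (star_clique a)) => //.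
- by rewrite divr_ge0 // mulr_ge0 // ltW.
- move=> y z; rewrite /schur_kernel b_sym; congr (_ + _).
  by apply: eq_bigr => x _; rewrite star_clique_sym.
- exact: star_clique_sym.
- move=> x g; rewrite -rE.
  by apply: (@star_clique_rel R U V b a mu (fun u => d u)) => // y; apply: da.
- by move=> g; rewrite schur_kernel_form lerDr lapform_ge0.
move=> S /asboolP[dS ngap]; apply: contrapT => hn; apply: ngap.
apply/star_gap_tri; rewrite mulrA.
apply: (star_gap_sampled (mu := mu)) => //.
- by move: lam_le; rewrite ler_pdivlMr // mulrC.
- by move=> x; rewrite divr_ge0 // ltW.
- move=> g; rewrite leNgt; apply/negP => hg; apply: hn; exists g.
  exact: hg.
- by move=> x; rewrite star_degE; have := m1_ok x; have := m2_ok x; lra.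
have dS2 u : \sum_x sampled q S x * (e x u)%:R <= 2 * d u.
  have -> : \sum_x sampled q S x * (e x u)%:R = weighted_degree (sampled q S) u.
    by apply: eq_bigr => x _; rewrite mulrC e_sym.
  have := dS u; have := ler0n R (degree e u); lra.
by case=> u /=; under eq_bigr do rewrite mulrA; rewrite -mulr_suml mulrA;
  apply: ler_wpM2r.
Qed.

End Step.

Lemma degree_ok_tail q dm k : 0 < q -> q <= 1 -> 0 < dm -> (forall u, dm <= d u) ->
  5 * k%:R <= q * dm ->
  expect q (fun S => `[< ~ degree_ok (sampled q S) >]%:R)
    <= #|V|%:R * (20 * k%:R / (q * dm)) ^+ k.
Proof.
move=> q0 q1 dm0 dm_le kq.
pose N u := [set v | e u v].
have wE S u : weighted_degree (sampled q S) u = #|N u :&: S|%:R / q.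
  rewrite /weighted_degree -sum_mem_card mulr_suml; apply: eq_bigr => v _.
  by rewrite !inE mulrA -natrM mulnb.
pose ok S u := #|N u|%:R / 2 <= (#|N u :&: S|%:R / q : R) <= 3 / 2 * #|N u|%:R.
apply: (@le_trans _ _ (expect q (fun S => \sum_u (~~ ok S u)%:R))).
  apply: ler_expect => [||S]; [exact: ltW|by []|].
  have [nok|] := asboolP; last by rewrite sumr_ge0.
  have [u hu] : exists u, ~~ ok S u.
    apply: contrapT => h; apply: nok => u; rewrite wE.
    by apply: contrapT => hu; apply: h; exists u; apply/negP.
  by rewrite (bigD1 u) //= hu lerDl sumr_ge0.
rewrite expect_sum -[X in X%:R * _]sum1_card natr_sum mulr_suml.
apply: ler_sum => u _; rewrite mul1r.
have du : dm <= #|N u|%:R := dm_le u.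
have qd : q * dm <= q * #|N u|%:R by rewrite ler_wpM2l // ltW.
have qdm : 0 < q * dm by rewrite mulr_gt0.
apply: le_trans (card_bernoulli_tail _ _ (k := k) _ _) _ => //.
- exact: le_trans qd.
- by rewrite -(ltr0n R); apply: lt_le_trans du.
have x0 : 0 <= 20 * k%:R / (q * #|N u|%:R).
  by rewrite divr_ge0 // mulr_ge0 // ltW.
apply: lerXn2r; rewrite ?nnegrE //; first by rewrite divr_ge0 ?mulr_ge0 ?(ltW qdm) // ltW.
apply: ler_wpM2l; first by rewrite mulr_ge0.
by rewrite lef_pV2 ?posrE //; apply: lt_le_trans qd.
Qed.

End TripartiteGap.

(** * The second entry of the sorted list of eigenvalues *)

Section Eigenvalues.
Variable R : realType.

Lemma char_poly_orthogonal n (P : 'M[R]_n) (t : 'rV[R]_n) : P *m P^T = 1%:M ->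
  char_poly (P^T *m diag_mx t *m P) = \prod_(i < n) ('X - (t 0 i)%:P).
Proof.
move=> P1; have PtP := mulmx1C P1.
have -> : \prod_(i < n) ('X - (t 0 i)%:P) = char_poly (diag_mx t).
  rewrite char_poly_trig; last exact: diag_mx_is_trig.
  by apply: eq_bigr => i _; rewrite mxE eqxx mulr1n.
rewrite /char_poly.
have -> : char_poly_mx (P^T *m diag_mx t *m P) =
    map_mx polyC P^T *m char_poly_mx (diag_mx t) *m map_mx polyC P.
  rewrite /char_poly_mx !map_mxM mulmxBr mulmxBl; congr (_ - _).
  by rewrite scalar_mxC -mulmxA -map_mxM PtP map_mx1 mulmx1.
rewrite !det_mulmx mulrAC -det_mulmx -map_mxM PtP map_mx1 det1 mul1r.
by [].
Qed.

Lemma sorted_flatten_nseq (s : seq R) (m : R -> nat) : sorted <=%R s ->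
  sorted <=%R (flatten [seq nseq (m x) x | x <- s]).
Proof.
rewrite !(sorted_pairwise le_trans).
elim: s => [//|x s IHs] /= /andP[/allP xs /IHs{}IHs].
rewrite pairwise_cat IHs andbT; apply/andP; split.
  apply/allrelP => y z /nseqP[-> _] /flattenP[_ /mapP[z' z's ->] /nseqP[-> _]].
  exact: xs.
by elim: (m x) => //= k ->; rewrite andbT; apply/allP => y /nseqP[->].
Qed.

Lemma eigenvalues_sorted n (A : 'M[R]_n) : sorted <=%R (eigenvalues A).
Proof.
apply: sorted_flatten_nseq; apply: sub_sorted (sorted_roots _ _ _).
by move=> x y /ltW.
Qed.

Lemma count_mem_eigenvalues n (A : 'M[R]_n) x :
  count_mem x (eigenvalues A) = mup x (char_poly A).
Proof.
have p0 : char_poly A != 0 by rewrite monic_neq0 // char_poly_monic.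
have memE y : (y \in rootsR (char_poly A)) = root (char_poly A) y.
  by rewrite -(roots_on_rootsR p0) /=.
have [xr|xnr] := boolP (x \in rootsR (char_poly A)); last first.
  rewrite mupNroot -?memE //; apply/eqP; rewrite -leqn0 leqNgt -has_count.
  apply/negP => /hasP[y /flattenP[_ /mapP[z zr ->] /nseqP[-> _]] /eqP zx].
  by rewrite -zx zr in xnr.
rewrite /eigenvalues; have := uniq_roots (- cauchy_bound (char_poly A))
  (cauchy_bound (char_poly A)) (char_poly A); rewrite -/(rootsR _).
elim: (rootsR _) xr => [//|y s IHs]; rewrite inE /= => /orP[/eqP<-|xs] /andP[yn us].
  rewrite count_cat count_nseq /= eqxx mul1n -[RHS]addn0; congr (_ + _)%N.
  apply/eqP; rewrite -leqn0 leqNgt -has_count.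
  apply/negP => /hasP[w /flattenP[_ /mapP[z zr ->] /nseqP[-> _]] /eqP zx].
  by rewrite -zx zr in yn.
rewrite count_cat count_nseq /= IHs //.
by case: eqP xs yn => [->|_ _ _] //= -> .
Qed.

(** Both lists contain x as often as its multiplicity as a root of the characteristic polynomial. *)
Lemma perm_eigenvalues n (P : 'M[R]_n) (t : 'rV[R]_n) : P *m P^T = 1%:M ->
  perm_eq (eigenvalues (P^T *m diag_mx t *m P)) [seq t 0 i | i <- enum 'I_n].
Proof.
move=> P1; apply/allP => x _ /=; apply/eqP.
rewrite count_mem_eigenvalues char_poly_orthogonal // -mu_prod_XsubC.
by rewrite big_map big_enum.
Qed.

Lemma nth1_sorted_ge (s : seq R) (z : R) : sorted <=%R s -> (1 < size s)%N ->
  (z <= s`_1) = (count (fun x : R => (x < z)%R) s <= 1)%N.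
Proof.
case: s => [//|a [//|b s]] /= /andP[ab bs] _.
have [zb|bz] := leP z b.
  have -> : count (fun x : R => (x < z)%R) s = 0%N.
    apply/eqP; rewrite -leqn0 leqNgt -has_count; apply/negP => /hasP[x xs].
    have := order_path_min le_trans bs => /allP/(_ x xs) bx.
    by rewrite ltNge (le_trans zb).
  by case: (a < z).
by rewrite (le_lt_trans ab bz).
Qed.

(** The second entry of a sorted list is at least z exactly when at most one entry lies below z; in
    this form the diagonal t need not be sorted. *)
Lemma second_eigenvalueP n (P : 'M[R]_n) (t : 'rV[R]_n) z : P *m P^T = 1%:M ->
  (1 < n)%N ->
  reflect (forall i j, t 0 i < z -> t 0 j < z -> i = j)
    (z <= (eigenvalues (P^T *m diag_mx t *m P))`_1).
Proof.
move=> P1 n1; set s := eigenvalues _.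
have sP : perm_eq s [seq t 0 i | i <- enum 'I_n] := perm_eigenvalues t P1.
rewrite nth1_sorted_ge ?eigenvalues_sorted //; last first.
  by rewrite (perm_size sP) size_map size_enum_ord.
have -> : count (fun x : R => (x < z)%R) s = #|[pred i | t 0 i < z]|.
  by rewrite (permP sP) count_map -size_filter enumT cardE [in RHS]/enum_mem;
    congr size; apply: eq_filter.
apply: (iffP idP) => [h i j ti tj|h].
  by move/card_le1_eqP: h; apply; rewrite inE.
by apply/card_le1_eqP => i j; rewrite !inE => ti tj; rewrite (h _ _ ti tj).
Qed.

End Eigenvalues.

(** * Expansion as a Poincare inequality for the Dirichlet form *)

Section NormalizedLaplacian.
Variables (R : realType) (V : finType) (e : rel V).
Hypotheses (e_sym : symmetric e) (deg_gt0 : forall u, (0 < degree e u)%N).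

Local Notation d u := ((degree e u)%:R : R).
Local Notation N := (normalized_laplacian_mx e R).

Definition dirichlet (f : V -> R) : R :=
  2^-1 * \sum_u \sum_v (e u v)%:R * (f u - f v) ^+ 2.

Let sd u : R := Num.sqrt (d u).

Let d_gt0 u : 0 < d u. Proof. by rewrite ltr0n. Qed.

Let sd_gt0 u : 0 < sd u. Proof. by rewrite sqrtr_gt0. Qed.

Let sd_sq u : sd u ^+ 2 = d u. Proof. by rewrite sqr_sqrtr. Qed.

Let e_symR u v : (e u v)%:R = (e v u)%:R :> R. Proof. by rewrite e_sym. Qed.

Lemma laplacian_lapmx :
  laplacian_mx e R = 2^-1 *: lapmx (fun u v => (e u v)%:R).
Proof.
apply/matrixP => i j; rewrite !mxE -degreeE.
by have [<-|_] := eqVneq i j; rewrite ?mulr1n ?mulr0n; field.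
Qed.

Lemma normalized_laplacian_sym : N^T = N.
Proof.
rewrite /normalized_laplacian_mx !trmx_mul laplacian_lapmx linearZ /= lapmx_sym //.
by rewrite tr_diag_mx mulmxA.
Qed.

Lemma qform_normalized_laplacian f :
  qform N (funrow (fun u => sd u * f u)) = dirichlet f.
Proof.
rewrite /normalized_laplacian_mx -{2}[degree_invsqrt_mx e R]trmxK tr_diag_mx.
rewrite qform_conj laplacian_lapmx qformZ.
have -> : funrow (fun u => sd u * f u) *m degree_invsqrt_mx e R = funrow f.
  rewrite mul_mx_diag; apply/rowP => i; rewrite !mxE -/(sd _).
  by rewrite mulrAC mulfV ?mul1r // gt_eqF.
by rewrite qform_lapmx.
Qed.

Lemma dirichlet_ge0 f : 0 <= dirichlet f.
Proof.
rewrite mulr_ge0 ?invr_ge0 //; apply: sumr_ge0 => u _; apply: sumr_ge0 => v _.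
by rewrite mulr_ge0 ?sqr_ge0.
Qed.

Lemma funrow_normsq (f : V -> R) :
  (funrow f *m (funrow f)^T) 0 0 = \sum_u f u ^+ 2.
Proof.
rewrite mulmx_rv_trE -[RHS]sum_enum_val; apply: eq_bigr => i _.
by rewrite !mxE expr2.
Qed.

Lemma funrow_sd_shift f a :
  funrow (fun u => sd u * (f u - a)) = funrow (fun u => sd u * f u) - a *: funrow sd.
Proof. by apply/rowP => i; rewrite !mxE; ring. Qed.

Lemma normsq_sd_shift f a :
  (funrow (fun u => sd u * (f u - a)) *m
     (funrow (fun u => sd u * (f u - a)))^T) 0 0 = \sum_u d u * (f u - a) ^+ 2.
Proof. by rewrite funrow_normsq; apply: eq_bigr => u _; rewrite exprMn sd_sq. Qed.

(** The vector [sd] is in the kernel, so in an eigenbasis it is supported on zero eigenvalues. At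
    most one eigenvalue is below zeta, so the support is a single coordinate [i0], and a suitable
    constant shift of f cancels exactly that coordinate. *)
Lemma expander_dirichlet zeta : (1 < #|V|)%N -> expander zeta e ->
  forall f, exists a, zeta * (\sum_u d u * (f u - a) ^+ 2) <= dirichlet f.
Proof.
move=> V1 /andP[/andP[z0 z1]].
have [P [t [P1 NE]]] := real_spectral normalized_laplacian_sym.
rewrite NE => /(second_eigenvalueP _ _ P1 V1) tz f.
have tE v : qform N v = \sum_i t 0 i * (v *m P^T) 0 i ^+ 2.
  by rewrite NE qform_conj_tr qform_diag.
have [y yE] : {y | y = funrow sd *m P^T} by exists (funrow sd *m P^T).
have t0 i : 0 <= t 0 i.
  have : 0 <= qform N (row i P).
    rewrite -[row i P]funrowE; set h := fun u : V => _.
    rewrite (_ : funrow h = funrow (fun u => sd u * (h u / sd u))).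
      by rewrite qform_normalized_laplacian dirichlet_ge0.
    by apply/rowP => j; rewrite !mxE mulrCA mulfV ?mulr1 // gt_eqF.
  rewrite tE -row_mul P1 row1 (bigD1 i) //= big1 => [|j ji].
    by rewrite mxE !eqxx expr1n mulr1 addr0.
  by rewrite mxE (negPf ji) andbF expr0n mulr0.
have ty i : t 0 i * y 0 i ^+ 2 = 0.
  have : qform N (funrow sd) = 0.
    have -> : funrow sd = funrow (fun u => sd u * 1).
      by apply/rowP => j; rewrite !mxE mulr1.
    rewrite qform_normalized_laplacian /dirichlet big1 ?mulr0 // => u _.
    by rewrite big1 // => v _; rewrite subrr expr0n mulr0.
  move/eqP; rewrite tE -yE psumr_eq0 => [/allP h|j _]; last first.
    by rewrite mulr_ge0 ?sqr_ge0.
  by apply/eqP; have := h i (mem_index_enum _).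
have [i0 yi0] : exists i, y 0 i != 0.
  apply/existsP; apply: contraT => /existsPn h.
  have y0 : y = 0 by apply/rowP => i; have := h i; rewrite negbK mxE => /eqP.
  have := orthogonal_normsq (funrow sd) P1; rewrite -yE y0 mul0mx mxE funrow_normsq.
  move/esym/eqP; rewrite psumr_eq0 => [/allP hs|u _]; last exact: sqr_ge0.
  have [u _] : exists u : V, true by move/ltnW: V1 => /card_gt0P[u _]; exists u.
  by have := hs u (mem_index_enum _); rewrite sd_sq gt_eqF.
have ti0 : t 0 i0 < zeta.
  have := ty i0; move/eqP; rewrite mulf_eq0 sqrf_eq0 (negPf yi0) orbF => /eqP ->.
  exact: z0.
have tz' j : j != i0 -> zeta <= t 0 j.
  by move=> ji; rewrite leNgt; apply: contra ji => tj; apply/eqP/tz.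
have yj j : j != i0 -> y 0 j = 0.
  move=> /tz' tj; have := ty j; move/eqP; rewrite mulf_eq0 sqrf_eq0 => /orP[|/eqP//].
  by rewrite gt_eqF // (lt_le_trans z0).
have [w wE] : {w | w = funrow (fun u => sd u * f u) *m P^T} by eexists.
exists (w 0 i0 / y 0 i0); rewrite -normsq_sd_shift -(orthogonal_normsq _ P1).
rewrite funrow_sd_shift mulmxBl -scalemxAl -wE -yE mulmx_rv_trE.
rewrite -qform_normalized_laplacian tE -wE (bigD1 i0) //= [leRHS](bigD1 i0) //=.
have -> : (w - (w 0 i0 / y 0 i0) *: y) 0 i0 = 0.
  by rewrite !mxE divfK // subrr.
rewrite mul0r add0r; apply: ler_wpDl; first by rewrite mulr_ge0 ?sqr_ge0.
rewrite mulr_sumr; apply: ler_sum => j ji.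
have -> : (w - (w 0 i0 / y 0 i0) *: y) 0 j = w 0 j.
  by rewrite !mxE (yj j) // mulr0 subr0.
by rewrite -expr2; apply: ler_wpM2r; rewrite ?sqr_ge0 ?tz'.
Qed.

(** Two eigenvalues below zeta would span a plane containing a nonzero vector w orthogonal to [sd].
    No shift along [sd] lowers the norm of w, while its form is less than zeta times its squared
    norm. *)
Lemma dirichlet_expander zeta : (1 < #|V|)%N -> 0 < zeta <= 1 ->
  (forall f, exists a, zeta * (\sum_u d u * (f u - a) ^+ 2) <= dirichlet f) ->
  expander zeta e.
Proof.
move=> V1 z01 gap; rewrite /expander z01 /=.
have [P [t [P1 NE]]] := real_spectral normalized_laplacian_sym.
rewrite NE; apply/(second_eigenvalueP _ _ P1 V1) => i j ti tj.
apply/eqP; apply: contraT => ij.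
have tE v : qform N v = \sum_i t 0 i * (v *m P^T) 0 i ^+ 2.
  by rewrite NE qform_conj_tr qform_diag.
have [y yE] : {y | y = funrow sd *m P^T} by exists (funrow sd *m P^T).
have [al [be [ab0 aby]]] : exists al be, 0 < al ^+ 2 + be ^+ 2 /\
    al * y 0 i + be * y 0 j = 0.
  have [yi|yi] := eqVneq (y 0 i) 0.
    by exists 1, 0; rewrite yi mulr0 mul0r expr0n expr1n !addr0 ltr01.
  exists (y 0 j), (- y 0 i); split; last by ring.
  by rewrite sqrrN ltr_wpDl ?sqr_ge0 // lt_neqAle sqr_ge0 eq_sym sqrf_eq0 yi.
pose w : 'rV[R]_#|V| := al *: delta_mx 0 i + be *: delta_mx 0 j.
have wi : w 0 i = al by rewrite !mxE !eqxx /= (negPf ij) mulr1 mulr0 addr0.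
have wj : w 0 j = be by rewrite !mxE !eqxx /= eq_sym (negPf ij) mulr1 mulr0 add0r.
have wk k : k != i -> k != j -> w 0 k = 0.
  by move=> ki kj; rewrite !mxE (negPf ki) (negPf kj) !mulr0 addr0.
pose f u := (w *m P) 0 (enum_rank u) / sd u.
have fE : funrow (fun u => sd u * f u) = w *m P.
  rewrite -[RHS]funrowE; apply/rowP => k; rewrite [LHS]mxE [RHS]mxE.
  by rewrite /f mulrCA mulfV ?mulr1 // gt_eqF.
have [a] := gap f; rewrite -qform_normalized_laplacian -normsq_sd_shift.
rewrite -(orthogonal_normsq _ P1) funrow_sd_shift fE tE mulmxBl -scalemxAl -yE.
rewrite -mulmxA P1 mulmx1 mulmx_rv_trE leNgt => /negP[].
have ji : j != i by rewrite eq_sym.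
rewrite (bigD1 i) //= (bigD1 j) //= big1 ?addr0; last first.
  by move=> k /andP[ki kj]; rewrite wk // expr0n mulr0.
rewrite [X in _ < _ * X](bigD1 i) //= [X in _ < _ * (_ + X)](bigD1 j) //=.
have wy k : (w - a *: y) 0 k = w 0 k - a * y 0 k by rewrite !mxE.
rewrite !wy wi wj.
set S := \sum_(_ | _) _.
have S0 : 0 <= S by apply: sumr_ge0 => k _; rewrite -expr2 sqr_ge0.
have /andP[z0 z1] := z01.
apply: (@lt_le_trans _ _ (zeta * (al ^+ 2 + be ^+ 2))).
  have [al0|al0] := eqVneq al 0.
    rewrite al0 expr0n mulr0 !add0r; rewrite al0 expr0n add0r in ab0.
    by rewrite ltr_pM2r.
  have al2 : 0 < al ^+ 2 by rewrite lt_neqAle sqr_ge0 eq_sym sqrf_eq0 al0.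
  rewrite mulrDr; apply: ltr_leD; first by rewrite ltr_pM2r.
  by apply: ler_wpM2r; rewrite ?sqr_ge0 // ltW.
apply: ler_wpM2l; first exact: ltW.
rewrite addrA; apply: ler_wpDr => //.
have h := mulr0 (2 * a); rewrite -aby in h.
have h1 : 0 <= (a * y 0 i) ^+ 2 by exact: sqr_ge0.
have h2 : 0 <= (a * y 0 j) ^+ 2 by exact: sqr_ge0.
rewrite -subr_ge0; set X := (X in 0 <= X).
have -> : X = (a * y 0 i) ^+ 2 + (a * y 0 j) ^+ 2
   - 2 * a * (al * y 0 i + be * y 0 j) by rewrite /X; ring.
by rewrite aby mulr0 subr0 addr_ge0.
Qed.

End NormalizedLaplacian.

(** * Minimum degree and induced degrees *)

Section MinDegree.
Variables (V : finType) (e : rel V).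

Lemma min_degree_le u : (min_degree e <= degree e u)%N.
Proof.
rewrite /min_degree; have := mem_index_enum u.
elim: (index_enum V) => [//|v r IHr]; rewrite inE big_cons.
by case/orP => [/eqP <-|/IHr h]; rewrite geq_min ?leqnn ?h ?orbT.
Qed.

(** The first hypothesis covers the neutral element of the minimum. *)
Lemma le_min_degree (R : numDomainType) (a : R) : a <= #|V|%:R ->
  (forall u, a <= (degree e u)%:R) -> a <= (min_degree e)%:R.
Proof.
move=> aV ad; apply: (big_ind (fun x => a <= x%:R)) => // x y ax ay.
by rewrite /minn; case: ifP.
Qed.

Lemma degree_induced (R : pzSemiRingType) (C : {set V}) (u : {u | u \in C}) :
  (degree (induced e C) u)%:R = \sum_(v in C) (e (val u) v)%:R :> R.
Proof.
rewrite /degree -sum_mem_card [RHS]big_sub. apply: eq_bigr => v _.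
by rewrite inE.
Qed.

End MinDegree.

(** * From Bernoulli subsets to uniform subsets of fixed size *)

Section UniformBernoulli.
Variables (R : realFieldType) (V : finType).
Implicit Types (A B C S : {set V}).

Lemma natr_prod_eq (f g : V -> bool) :
  ([forall v, f v == g v])%:R = \prod_v ((f v == g v)%:R : R).
Proof.
have [/forallP h|/forallPn[v fg]] := boolP [forall v, f v == g v].
  by rewrite big1 // => v _; rewrite h.
by rewrite (bigD1 v) //= (negPf fg) mul0r.
Qed.

(** F is expanded over the possible values C of the union; the indicator of [A :|: B == C] is a
    product over the vertices, so the double expectation factors. *)
Lemma expect_union (p q : R) (F : {set V} -> R) :
  expect p (fun A => expect q (fun B => F (A :|: B)))
    = expect (1 - (1 - p) * (1 - q)) F.
Proof.
pose X A B C : R := \prod_v (((v \in A) || (v \in B)) == (v \in C))%:R.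
have XE A B C : X A B C = (A :|: B == C)%:R.
  rewrite /X -natr_prod_eq; congr _%:R; congr nat_of_bool.
  apply/forallP/eqP => [h|<- v]; last by rewrite in_setU.
  by apply/setP => v; rewrite in_setU (eqP (h v)).
have FE A B : F (A :|: B) = \sum_C X A B C * F C.
  rewrite (bigD1 (A :|: B)) //= XE eqxx mul1r big1 ?addr0 // => C.
  by rewrite XE eq_sym => /negPf ->; rewrite mul0r.
have inner A C : expect q (fun B => X A B C) =
    \prod_v (q * (true == (v \in C))%:R + (1 - q) * ((v \in A) == (v \in C))%:R).
  rewrite prod_add_set; apply: eq_bigr => B _.
  rewrite /bernoulli -big_split; apply: eq_bigr => v _ /=.
  by case: (v \in B); rewrite ?orbT ?orbF.
have outer C : expect p (fun A => expect q (fun B => X A B C)) =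
    bernoulli (1 - (1 - p) * (1 - q)) C.
  transitivity (\prod_v (p * (q * (true == (v \in C))%:R + (1 - q) * (true == (v \in C))%:R)
     + (1 - p) * (q * (true == (v \in C))%:R + (1 - q) * (false == (v \in C))%:R))).
    rewrite prod_add_set; apply: eq_bigr => A _.
    rewrite inner /bernoulli -big_split; apply: eq_bigr => v _ /=.
    by case: (v \in A).
  by apply: eq_bigr => v _; case: (v \in C) => /=; ring.
transitivity (\sum_C expect p (fun A => expect q (fun B => X A B C * F C))).
  rewrite -expect_sum; apply: eq_expect => A.
  by rewrite -expect_sum; apply: eq_expect => B.
apply: eq_bigr => C _; rewrite -outer mulrC -expectZ; apply: eq_expect => A.
by rewrite -expectZ; apply: eq_expect => B; rewrite mulrC.
Qed.

(* The terms of the expansion of (s + (n - s)) ^ n are largest at s. *)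
Lemma binomial_mode n s : (s <= n)%N ->
  (n ^ n <= n.+1 * ('C(n, s) * (s ^ s * (n - s) ^ (n - s))))%N.
Proof.
move=> sn; pose b k := ('C(n, k) * (s ^ k * (n - s) ^ (n - k)))%N.
have up k : (k < s)%N -> (b k <= b k.+1)%N.
  move=> ks; have kn : (k < n)%N := leq_trans ks sn.
  rewrite -(leq_pmul2l (ltn0Sn k)) /b [leqRHS]mulnA mul_bin_left.
  rewrite -(subnSK kn) !expnS.
  set B := 'C(n, k); set x := (s ^ k)%N; set y := (_ ^ (n - k.+1))%N.
  have -> : (k.+1 * (B * (x * ((n - s) * y))) = k.+1 * (n - s) * (B * x * y))%N by ring.
  have -> : ((n - k.+1).+1 * B * (s * x * y) = (n - k.+1).+1 * s * (B * x * y))%N by ring.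
  rewrite subnSK // leq_mul2r; apply/orP; right.
  by rewrite [leqRHS]mulnC; apply: leq_mul => //; apply: leq_sub2l; apply: ltnW.
have down k : (s <= k)%N -> (k < n)%N -> (b k.+1 <= b k)%N.
  move=> sk kn.
  rewrite -(leq_pmul2l (ltn0Sn k)) /b mulnA mul_bin_left.
  rewrite -(subnSK kn) !expnS.
  set B := 'C(n, k); set x := (s ^ k)%N; set y := (_ ^ (n - k.+1))%N.
  have -> : (k.+1 * (B * (x * ((n - s) * y))) = k.+1 * (n - s) * (B * x * y))%N by ring.
  have -> : ((n - k.+1).+1 * B * (s * x * y) = (n - k.+1).+1 * s * (B * x * y))%N by ring.
  rewrite subnSK // leq_mul2r; apply/orP; right.
  by rewrite mulnC; apply: leq_mul; [apply: leqW | apply: leq_sub2l].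
have le_lo j : (j <= s)%N -> (b (s - j) <= b s)%N.
  elim: j => [|j IHj] js; first by rewrite subn0.
  apply: leq_trans (IHj (ltnW js)); rewrite -(subnSK js); apply: up.
  by rewrite ltn_subrL (leq_ltn_trans _ js).
have le_hi j : (s + j <= n)%N -> (b (s + j) <= b s)%N.
  elim: j => [|j IHj] jn; first by rewrite addn0.
  rewrite addnS in jn *; apply: leq_trans (IHj (ltnW jn)).
  by apply: down => //; apply: leq_addr.
have -> : (n ^ n = \sum_(k < n.+1) b k)%N.
  rewrite -{1}(subnKC sn) addnC expnDn; apply: eq_bigr => k _.
  by rewrite /b (mulnC (s ^ k)%N).
have -> : (n.+1 * ('C(n, s) * (s ^ s * (n - s) ^ (n - s))) = \sum_(k < n.+1) b s)%N.
  by rewrite sum_nat_const card_ord.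
apply: leq_sum => k _; have [ks|sk] := leqP k s.
  by rewrite -(subKn ks); apply: le_lo; apply: leq_subr.
rewrite -(subnKC (ltnW sk)); apply: le_hi.
by rewrite subnKC ?(ltnW sk) // -ltnS.
Qed.

Lemma bernoulli_card (p : R) S :
  bernoulli p S = p ^+ #|S| * (1 - p) ^+ (#|V| - #|S|).
Proof.
rewrite /bernoulli (bigID (mem S)) /=; congr (_ * _).
  by rewrite -prodr_const; apply: eq_bigr => v ->.
rewrite -(cardC (mem S)) addKn -prodr_const.
by apply: eq_big => [v|v /negPf ->]; rewrite ?inE.
Qed.

End UniformBernoulli.

Section UniformSubset.
Variables (R : realType) (V : finType).

(** All sets of size s have the same weight w, so the uniform law is the Bernoulli law conditioned
    on the size, and conditioning multiplies failure probabilities by at most [n.+1]. *)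
Lemma prob_random_subset_ge s (P good : pred {set V}) : (0 < #|V|)%N ->
  (s <= #|V|)%N -> (forall C : {set V}, #|C| = s -> good C -> P C) ->
  1 - #|V|.+1%:R * expect (s%:R / #|V|%:R) (fun C => (~~ good C)%:R)
    <= prob_random_subset R s P.
Proof.
move=> V0 sV goodP; set n := #|V| in V0 sV *; set p : R := s%:R / n%:R.
have n0 : n%:R != 0 :> R by rewrite pnatr_eq0 -lt0n.
have p0 : 0 <= p by rewrite divr_ge0.
have p1 : p <= 1 by rewrite ler_pdivrMr ?ltr0n // mul1r ler_nat.
have cs : #|[set C : {set V} | #|C| == s]| = 'C(n, s) by rewrite card_draws.
have cs0 : 0 < 'C(n, s)%:R :> R by rewrite ltr0n bin_gt0.
pose w : R := p ^+ s * (1 - p) ^+ (n - s).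
have w1 : 1 <= n.+1%:R * ('C(n, s)%:R * w).
  have nn : 0 < n%:R ^+ n :> R by rewrite exprn_gt0 // ltr0n.
  have -> : w = s%:R ^+ s * (n - s)%:R ^+ (n - s) / n%:R ^+ n.
    have p'E : 1 - p = (n - s)%:R / n%:R by rewrite natrB // mulrBl mulfV.
    have nE : n%:R ^+ n = n%:R ^+ s * n%:R ^+ (n - s) :> R by rewrite -exprD subnKC.
    by rewrite /w p'E /p !expr_div_n nE invfM; ring.
  rewrite !mulrA ler_pdivlMr // mul1r -!natrX -!natrM ler_nat.
  by rewrite -!mulnA; apply: binomial_mode.
have bad : #|[set C : {set V} | (#|C| == s) && ~~ P C]|%:R * w
    <= expect p (fun C => (~~ good C)%:R).
  rewrite -sum_mem_card mulr_suml; apply: ler_sum => C _.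
  rewrite inE; have [/eqP Cs|_] := boolP (#|C| == s); last first.
    by rewrite mul0r mulr_ge0 // bernoulli_ge0.
  rewrite bernoulli_card Cs -/w mulrC; apply: ler_wpM2l.
    by rewrite mulr_ge0 // exprn_ge0 // subr_ge0.
  by rewrite ler_nat; have := goodP C Cs; case: (P C); case: (good C) => // ->.
have sE : #|[set C : {set V} | (#|C| == s) && P C]|%:R
    = 'C(n, s)%:R - #|[set C : {set V} | (#|C| == s) && ~~ P C]|%:R :> R.
  apply/eqP; rewrite eq_sym subr_eq -natrD -cs; apply/eqP; congr _%:R.
  rewrite -cardsUI [X in (_ + X)%N](_ : _ = 0)%N ?addn0.
    by apply: eq_card => C; rewrite !inE -andb_orr orbN andbT.
  by apply/eqP; rewrite cards_eq0; apply/eqP/setP => C; rewrite !inE; case: (P C); rewrite ?andbF.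
rewrite /prob_random_subset cs sE mulrBl mulfV ?gt_eqF // lerD2l lerN2.
rewrite ler_pdivrMr //.
set N := #|_|%:R in bad *; set E := expect _ _ in bad *.
apply: (@le_trans _ _ (N * (n.+1%:R * ('C(n, s)%:R * w)))).
  by rewrite -[leLHS]mulr1; apply: ler_wpM2l.
have -> : N * (n.+1%:R * ('C(n, s)%:R * w)) = n.+1%:R * 'C(n, s)%:R * (N * w) by ring.
have -> : n.+1%:R * E * 'C(n, s)%:R = n.+1%:R * 'C(n, s)%:R * E by ring.
by apply: ler_wpM2l; rewrite // mulr_ge0.
Qed.

End UniformSubset.

(** * Thinning all three layers and passing to the induced graph *)

Lemma stage_bounds (R : realFieldType) (z : R) : 0 < z -> z <= 1 ->
  [/\ z / 242 <= z / 2 /\ z / 2 <= 1 / 2,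
      z / 242 <= z / 2 / 11 /\ z / 2 / 11 <= 1 / 2 &
      z / 242 <= z / 2 / 11 / 11 /\ z / 2 / 11 / 11 <= 1 / 2].
Proof. by move=> z0 z1; split; split; lra. Qed.

Section RandomInduced.
Variables (R : realType) (V : finType) (e : rel V).
Hypothesis e_sym : symmetric e.
Implicit Types (A B C S : {set V}) (m : V -> R).

Local Notation d u := ((degree e u)%:R : R).

Lemma sampled_ge0 (q : R) S u : 0 < q -> 0 <= sampled q S u.
Proof. by move=> q0; rewrite divr_ge0 // ltW. Qed.

Lemma weighted_degree_sampled (q : R) S u :
  weighted_degree e (sampled q S) u = (\sum_(v in S) (e u v)%:R) / q.
Proof.
rewrite /weighted_degree mulr_suml [RHS]big_mkcond; apply: eq_bigr => v _.
by rewrite /sampled; case: (v \in S); rewrite ?mul1r ?mul0r ?mulr0.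
Qed.

Definition induced_gap lam C := forall f : {u | u \in C} -> R, exists t,
  lam * (\sum_u (degree (induced e C) u)%:R * (f u - t) ^+ 2)
    <= dirichlet (induced e C) f.

(** The same F is used on all layers; its value 0 outside S meets only zero weights. A vertex of S
    lies in some layer and has induced degree at most [9 / 2 * q * d u], so the masses are at least
    [2 / 9 / q ^+ 2 * Y], while the three cross forms total at most [3 * X / q ^+ 2]. Since the
    Dirichlet form is [X / 2], the quotient is 27. *)
Lemma tri_gap_induced lam p q A B C :
  0 < lam -> 0 < p -> 0 < q -> p <= 3 * q ->
  tri_gap e lam (sampled q A) (sampled q B) (sampled q C) ->
  degree_ok e (sampled p (A :|: B :|: C)) ->
  induced_gap (lam / 27) (A :|: B :|: C).
Proof.
move=> lam0 p0 q0 pq gap dok; set S := A :|: B :|: C in dok *.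
move=> f; pose F u := oapp f 0 (insub u).
have Ff (u : {u | u \in S}) : F (val u) = f u by rewrite /F valK.
have [t ht] := gap F F F; exists t.
pose X := \sum_(u in S) \sum_(v in S) (e u v)%:R * (F u - F v) ^+ 2.
pose Y := \sum_(u in S) (\sum_(v in S) (e u v)%:R) * (F u - t) ^+ 2.
have -> : \sum_u (degree (induced e S) u)%:R * (f u - t) ^+ 2 = Y.
  by rewrite /Y [RHS]big_sub; apply: eq_bigr => u _; rewrite degree_induced Ff.
have -> : dirichlet (induced e S) f = 2^-1 * X.
  rewrite /X [in RHS]big_sub; congr (_ * _); apply: eq_bigr => u _.
  by rewrite [RHS]big_sub; apply: eq_bigr => v _; rewrite !Ff.
have crossX A' B' : A' \subset S -> B' \subset S ->
    cross e (sampled q A') (sampled q B') F F <= X / q ^+ 2.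
  move=> /subsetP AS /subsetP BS; rewrite /X big_mkcond mulr_suml; apply: ler_sum => u _.
  rewrite [X in (if _ then X else _)]big_mkcond /=.
  have [uS|uS] := boolP (u \in S); last first.
    rewrite mul0r big1 // => v _; rewrite /sampled.
    by rewrite (negPf (contra (AS u) uS)) !mul0r mulr0 mul0r.
  rewrite mulr_suml; apply: ler_sum => v _.
  have [vS|vS] := boolP (v \in S); last first.
    by rewrite /sampled (negPf (contra (BS v) vS)) !mul0r !mulr0 !mul0r.
  have -> : (e u v)%:R * (sampled q A' u * sampled q B' v) * (F u - F v) ^+ 2 =
     ((u \in A')%:R * (v \in B')%:R) * ((e u v)%:R * (F u - F v) ^+ 2 / q ^+ 2).
    by rewrite /sampled; field; rewrite gt_eqF.
  have z0 : 0 <= (e u v)%:R * (F u - F v) ^+ 2 / q ^+ 2.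
    by rewrite divr_ge0 ?sqr_ge0 // mulr_ge0 ?sqr_ge0.
  by apply: ler_piMl => //; case: (u \in A'); case: (v \in B'); rewrite ?mulr1 ?mulr0 ?ler01 ?lexx.
have sA : A \subset S by rewrite /S -setUA subsetUl.
have sB : B \subset S by rewrite /S (setUC A) -setUA subsetUl.
have sC : C \subset S by rewrite /S subsetUr.
have up : cross e (sampled q A) (sampled q B) F F
   + cross e (sampled q B) (sampled q C) F F
   + cross e (sampled q C) (sampled q A) F F <= 3 * (X / q ^+ 2).
  have := crossX A B sA sB; have := crossX B C sB sC; have := crossX C A sC sA; lra.
have degS u : \sum_(v in S) (e u v)%:R <= 9 / 2 * q * d u.
  have /andP[_] := dok u; rewrite weighted_degree_sampled ler_pdivrMr // => h.
  apply: le_trans h _.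
  have := ler_wpM2r (ler0n R (degree e u)) pq; lra.
have low : 2 / 9 / q ^+ 2 * Y <= mass e (sampled q A) F t + mass e (sampled q B) F t
   + mass e (sampled q C) F t.
  rewrite /Y big_mkcond mulr_sumr /mass -!big_split; apply: ler_sum => u _ /=.
  have x0 := sqr_ge0 (F u - t).
  have a0 S' : 0 <= d u * sampled q S' u * (F u - t) ^+ 2.
    by apply: mulr_ge0 => //; apply: mulr_ge0 => //; apply: sampled_ge0.
  have [uS|uS] := ifP; last by rewrite mulr0 !addr_ge0.
  have a1 S' : u \in S' -> 2 / 9 / q ^+ 2 * ((\sum_(v in S) (e u v)%:R) * (F u - t) ^+ 2)
      <= d u * sampled q S' u * (F u - t) ^+ 2.
    move=> uS'; rewrite mulrA; apply: ler_wpM2r => //.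
    rewrite /sampled uS' mul1r.
    have -> : d u / q = 2 / 9 / q ^+ 2 * (9 / 2 * q * d u) by field; rewrite gt_eqF.
    by apply: ler_wpM2l => //; rewrite divr_ge0 ?sqr_ge0 // divr_ge0.
  have := uS; rewrite /S !in_setU -orbA => /or3P[] /a1 h.
  - apply: le_trans h _; rewrite -addrA lerDl; exact: addr_ge0.
  - apply: le_trans h _; rewrite -addrA addrCA lerDl; exact: addr_ge0.
  - by apply: le_trans h _; rewrite lerDr addr_ge0.
have q2 : 0 < q ^+ 2 by rewrite exprn_gt0.
have main : lam * (2 / 9 / q ^+ 2 * Y) <= 3 * (X / q ^+ 2).
  apply: le_trans up; apply: le_trans ht; apply: ler_wpM2l => //; exact: ltW.
have : lam * (2 / 9 * Y) <= 3 * X.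
  rewrite -(ler_pM2r (x := (q ^+ 2)^-1)) ?invr_gt0 //.
  have -> : lam * (2 / 9 * Y) / q ^+ 2 = lam * (2 / 9 / q ^+ 2 * Y) by ring.
  by rewrite -[leRHS]mulrA.
lra.
Qed.

Lemma expect_bad_and q eps (P Q : {set V} -> Prop) : 0 <= q -> q <= 1 ->
  expect q (fun S => `[< ~ P S >]%:R) <= eps ->
  forall eps', expect q (fun S => `[< P S /\ ~ Q S >]%:R) <= eps' ->
  expect q (fun S => `[< ~ (P S /\ Q S) >]%:R) <= eps + eps' :> R.
Proof.
move=> q0 q1 h eps' h'; apply: le_trans (lerD h h'); rewrite -expectD.
apply: ler_expect => // S; rewrite -natrD ler_nat.
case: asboolP => // nPQ; case: asboolP => [//|/contrapT PS].
by case: asboolP => // nn; case: nn; split=> // QS; apply: nPQ.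
Qed.

Lemma expect_bad_dep q q' eps eps' (P : {set V} -> Prop)
    (F : {set V} -> {set V} -> R) : 0 <= q -> q <= 1 -> 0 <= q' -> q' <= 1 ->
  0 <= eps' ->
  expect q (fun S => `[< ~ P S >]%:R) <= eps ->
  (forall S S', F S S' <= 1) ->
  (forall S, P S -> expect q' (F S) <= eps') ->
  expect q (fun S => expect q' (F S)) <= eps + eps'.
Proof.
move=> q0 q1 q'0 q'1 e0 h F1 hF.
rewrite -[eps'](expect_cst V q); apply: le_trans (lerD h (lexx _)); rewrite -expectD.
apply: ler_expect => // S; case: asboolP => [_|/contrapT PS]; last first.
  by rewrite add0r; apply: hF.
apply: ler_wpDr => //; rewrite -(expect_cst V q' 1).
exact: ler_expect.
Qed.

Section Probability.
Variables (zeta dm q rho : R) (k : nat).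
Hypotheses (zeta_gt0 : 0 < zeta) (zeta_le1 : zeta <= 1).
Hypotheses (dm_gt0 : 0 < dm) (dm_le : forall u, dm <= d u).
Hypotheses (q_gt0 : 0 < q) (q_le1 : q <= 1) (rho_le : rho <= 1 / 4).
Hypothesis rho_ge : 20 * k%:R * 242 / (zeta * dm * q) <= rho.

Local Notation one := (fun=> 1 : R).

(** Of the factor 3, one part is the union bound for the degrees and two are the dimension of the
    matrices. The bound 1/4 on rho yields the smallness condition on k. *)
Let stage lam m1 m2 : zeta / 242 <= lam -> lam <= 1 / 2 ->
  (forall u, 0 <= m1 u) -> (forall u, 0 <= m2 u) ->
  degree_ok e m1 -> degree_ok e m2 -> tri_gap e lam m1 m2 one ->
  expect q (fun S => `[< ~ (degree_ok e (sampled q S) /\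
      tri_gap e (lam / 11) m1 m2 (sampled q S)) >]%:R) <= 3 * #|V|%:R * rho ^+ k.
Proof.
move=> lamz lam2 m10 m20 ok1 ok2 gap.
have lam0 : 0 < lam by apply: lt_le_trans lamz; rewrite divr_gt0.
have den0 : 0 < zeta * dm * q by rewrite !mulr_gt0.
have den1 : 0 < lam * dm * q by rewrite !mulr_gt0.
have k0 : 0 <= 20 * k%:R :> R by rewrite mulr_ge0.
have xE : 20 * k%:R * (1 / (lam * dm)) / q = 20 * k%:R / (lam * dm * q).
  by field; rewrite !gt_eqF.
have x1 : 20 * k%:R * (1 / (lam * dm)) / q <= rho.
  apply: le_trans rho_ge; rewrite xE.
  rewrite -[leRHS]mulrA; apply: ler_wpM2l => //.
  rewrite -[leRHS]invf_div lef_pV2 ?posrE //; last by rewrite divr_gt0.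
  rewrite mulrAC -mulrA mulrC -mulrA mulrAC.
  by have := ler_wpM2r (ltW (mulr_gt0 dm_gt0 q_gt0)) lamz; lra.
have x2 : 20 * k%:R / (q * dm) <= rho.
  apply: le_trans x1; have -> : 20 * k%:R * (1 / (lam * dm)) / q = 20 * k%:R / (q * dm) / lam.
    by field; rewrite !gt_eqF.
  rewrite ler_pdivlMr //; apply: ler_piMr; last by apply: le_trans lam2 _; lra.
  by rewrite divr_ge0 // mulr_ge0 // ltW.
have y1 : 0 <= 20 * k%:R * (1 / (lam * dm)) / q.
  by rewrite xE divr_ge0 // ltW.
have y2 : 0 <= 20 * k%:R / (q * dm) by rewrite divr_ge0 // mulr_ge0 // ltW.
have -> : 3 * #|V|%:R * rho ^+ k = #|V|%:R * rho ^+ k + (2 * #|V|)%:R * rho ^+ k.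
  by rewrite natrM; ring.
apply: (@expect_bad_and q _ (fun S => degree_ok e (sampled q S))
   (fun S => tri_gap e (lam / 11) m1 m2 (sampled q S))) => //; first exact: ltW.
  have kq : 5 * k%:R <= q * dm.
    have : 20 * k%:R / (q * dm) <= 1 / 4 by apply: le_trans rho_le.
    by rewrite ler_pdivrMr ?mulr_gt0 //; lra.
  apply: le_trans (degree_ok_tail q_gt0 q_le1 dm_gt0 dm_le kq) _.
  by apply: ler_wpM2l => //; apply: lerXn2r; rewrite ?nnegrE // (le_trans y2).
have kq : 5 * k%:R * (1 / (lam * dm)) <= q.
  have : 20 * k%:R * (1 / (lam * dm)) / q <= 1 / 4 by apply: le_trans rho_le.
  by rewrite ler_pdivrMr //; move: (1 / (lam * dm)) => v; have := q_gt0; lra.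
apply: le_trans (tri_step_tail e_sym lam0 lam2 dm_gt0 dm_le q_gt0 q_le1 m10 m20 ok1 ok2 gap kq) _.
by apply: ler_wpM2l => //; apply: lerXn2r; rewrite ?nnegrE // (le_trans y1).
Qed.

Lemma tri_gap_probability :
  tri_gap e (zeta / 2) one one one ->
  expect q (fun A => expect q (fun B => expect q (fun C =>
    `[< ~ tri_gap e (zeta / 2662) (sampled q A) (sampled q B) (sampled q C) >]%:R)))
  <= 9 * #|V|%:R * rho ^+ k.
Proof.
move=> gap0.
have k0 : 0 <= 20 * k%:R * 242 :> R by rewrite !mulr_ge0.
have rho0 : 0 <= rho by apply: le_trans rho_ge; rewrite divr_ge0 // ltW // !mulr_gt0.
have eps0 : 0 <= 3 * #|V|%:R * rho ^+ k by rewrite mulr_ge0 ?mulr_ge0 ?exprn_ge0.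
have one0 (u : V) : 0 <= one u by [].
have s0 S u : 0 <= sampled q S u := sampled_ge0 S u q_gt0.
have ok1 := degree_ok1 R e.
have q0 := ltW q_gt0.
have -> : 9 * #|V|%:R * rho ^+ k = 3 * #|V|%:R * rho ^+ k
   + (3 * #|V|%:R * rho ^+ k + 3 * #|V|%:R * rho ^+ k) by ring.
have ind1 (b : bool) : (b%:R : R) <= 1 by case: b.
have E1 (F : {set V} -> R) : (forall S, F S <= 1) -> expect q F <= 1.
  by move=> h; rewrite -[leRHS](expect_cst V q); apply: ler_expect.
(* The stages start from the gaps [zeta / 2], [zeta / 22] and [zeta / 242]; rho is adapted to the
   last and smallest. *)
have [[z1 h1] [z2 h2] [z3 h3]] := stage_bounds zeta_gt0 zeta_le1.
apply: (expect_bad_dep (P := fun A => degree_ok e (sampled q A) /\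
    tri_gap e (zeta / 2 / 11) one one (sampled q A))) => //.
- by rewrite addr_ge0.
- exact: stage.
- by move=> A B; apply: E1.
move=> A [okA /tri_gap_rotate gapA].
apply: (expect_bad_dep (P := fun B => degree_ok e (sampled q B) /\
    tri_gap e (zeta / 2 / 11 / 11) one (sampled q A) (sampled q B))) => //.
  apply: stage => //; exact: (tri_gap_rotate (tri_gap_rotate gapA)).
move=> B [okB /tri_gap_rotate gapB].
have := stage z3 h3 (s0 A) (s0 B) okA okB gapB.
apply: le_trans; apply: ler_expect => // C; rewrite ler_nat.
case: asboolP => // ngap; case: asboolP => // nn; case: nn => -[_ gapC].
apply: ngap; have -> : zeta / 2662 = zeta / 2 / 11 / 11 / 11 by field.
exact: gapC.
Qed.

(** Nine of the ten terms come from the three stages, and the tenth from the degrees into the union,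
    which is itself Bernoulli(p). *)
Lemma induced_gap_probability (p : R) : 0 < p -> p <= 1 -> p <= 3 * q ->
  p = 1 - (1 - (1 - (1 - q) * (1 - q))) * (1 - q) -> q <= p ->
  tri_gap e (zeta / 2) one one one ->
  expect p (fun C => `[< ~ (degree_ok e (sampled p C) /\
     induced_gap (zeta / 2662 / 27) C) >]%:R) <= 10 * #|V|%:R * rho ^+ k.
Proof.
move=> p0 p1 pq pE qp gap0.
have q0 := ltW q_gt0.
have k0 : 0 <= 20 * k%:R :> R by rewrite mulr_ge0.
have x2 : 20 * k%:R / (p * dm) <= rho.
  apply: le_trans rho_ge.
  have -> : 20 * k%:R * 242 / (zeta * dm * q) = 20 * k%:R / (q * dm) * (242 / zeta).
    by field; rewrite !gt_eqF.
  apply: (@le_trans _ _ (20 * k%:R / (q * dm))).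
    apply: ler_wpM2l => //; rewrite lef_pV2 ?posrE ?mulr_gt0 //.
    by apply: ler_wpM2r => //; exact: ltW.
  apply: ler_peMr; first by rewrite divr_ge0 // mulr_ge0 // ltW.
  by rewrite ler_pdivlMr // mul1r (le_trans zeta_le1) // ler1n.
have y2 : 0 <= 20 * k%:R / (p * dm) by rewrite divr_ge0 // mulr_ge0 // ltW.
have -> : 10 * #|V|%:R * rho ^+ k = #|V|%:R * rho ^+ k + 9 * #|V|%:R * rho ^+ k by ring.
apply: (@expect_bad_and p _ (fun C => degree_ok e (sampled p C))
   (fun C => induced_gap (zeta / 2662 / 27) C)) => //; first exact: ltW.
  have kq : 5 * k%:R <= p * dm.
    have : 20 * k%:R / (p * dm) <= 1 / 4 by apply: le_trans rho_le.
    by rewrite ler_pdivrMr ?mulr_gt0 //; lra.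
  apply: le_trans (degree_ok_tail p0 p1 dm_gt0 dm_le kq) _.
  by apply: ler_wpM2l => //; apply: lerXn2r; rewrite ?nnegrE // (le_trans y2).
apply: le_trans (tri_gap_probability gap0).
rewrite {1}pE -expect_union -expect_union.
apply: ler_expect => // A; apply: ler_expect => // B; apply: ler_expect => // C.
rewrite ler_nat; case: asboolP => // -[okS nind]; case: asboolP => // ngap.
case: nind; apply: (tri_gap_induced _ p0 q_gt0 pq (contrapT ngap) okS).
by rewrite divr_gt0.
Qed.

End Probability.

End RandomInduced.

(** * Numerical estimates *)

Section Numerics.
Variable R : realType.

Lemma expR1_lt3 : expR 1 < 3 :> R.
Proof.
(* The exponent 6 is the first that works: [(4 / 5) ^+ 5 < 1 / 3 < (5 / 6) ^+ 6]. *)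
have h : (5 / 6) ^+ 6 <= expR (- 1) :> R.
  have -> : (-1 : R) = 6%:R * (- 6^-1) by field.
  rewrite expRM_natl; apply: lerXn2r; rewrite ?nnegrE ?expR_ge0 ?divr_ge0 //.
  by apply: le_trans _ (expR_ge1Dx _); lra.
rewrite expRN in h; rewrite -[ltLHS]invrK invf_plt ?posrE ?invr_gt0 ?expR_gt0 //.
by apply: lt_le_trans h; rewrite !exprS expr0; lra.
Qed.

Lemma ln_gt1 (n : nat) : (2 < n)%N -> 1 < ln n%:R :> R.
Proof.
move=> n2; rewrite -ltr_expR lnK ?posrE ?ltr0n ?(ltn_trans _ n2) //.
by apply: lt_le_trans expR1_lt3 _; rewrite ler_nat.
Qed.

(* K stands for n ^ (1 / ln ln n). *)
Lemma lnln_root (n : nat) : (2 < n)%N -> exists (K : R) (k : nat),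
  [/\ forall j : nat, n%:R `^ (j%:R / ln (ln n%:R)) = K ^+ j,
      2 <= K, k%:R <= K ^+ 4 & n%:R <= K ^+ k].
Proof.
move=> n2; set x : R := ln n%:R; have x1 : 1 < x := ln_gt1 n2.
have n0 : 0 < n%:R :> R by rewrite ltr0n (ltn_trans _ n2).
set y := ln x; have y0 : 0 < y by apply: ln_gt0.
have xE : x = expR y by rewrite lnK // posrE (lt_trans _ x1).
have nE : n%:R = expR x by rewrite lnK // posrE.
have /andP[k1 k2] := truncn_itv (ltW y0).
(* Since [x = expR y], this says [y + y ^+ 2 / 4 <= expR y], and the left side is
   [(1 + y / 2) ^+ 2 - 1]. It yields both [2 <= K] and [k%:R <= K ^+ 4]. *)
have lnK1 : 1 + y / 4 <= x / y.
  rewrite ler_pdivlMr // xE.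
  have h : 1 + y / 2 <= expR (y / 2) := expR_ge1Dx _.
  have -> : expR y = expR (y / 2) ^+ 2 by rewrite -expRM_natl; congr expR; field.
  apply: (@le_trans _ _ ((1 + y / 2) ^+ 2)).
    rewrite -subr_ge0; set X := (X in 0 <= X).
    by have -> : X = 1 by rewrite /X; field.
  by apply: lerXn2r; rewrite ?nnegrE ?expR_ge0 // addr_ge0 // divr_ge0 // ltW.
(* The successor of the truncation exceeds y, so [K ^+ k] reaches [expR x]. *)
exists (expR (x / y)), (Num.truncn y).+1; split.
- move=> j; rewrite /powR gt_eqF // -/x -/y -expRM_natl; congr expR; ring.
- apply: le_trans _ (expR_ge1Dx _); lra.
- rewrite -expRM_natl; apply: le_trans _ (expR_ge1Dx _).
  by rewrite -addn1 natrD; lra.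
rewrite nE -expRM_natl ler_expR mulrA ler_pdivlMr // mulrC ler_pM2r; last exact: lt_trans x1.
exact: ltW.
Qed.

Lemma union_rate (p : R) : 0 < p -> p <= 1 -> exists q,
  [/\ 0 < q, q <= 1, p <= 3 * q, q <= p
    & p = 1 - (1 - (1 - (1 - q) * (1 - q))) * (1 - q)].
Proof.
move=> p0 p1; pose r := (1 - p) `^ (3^-1).
have r0 : 0 <= r := powR_ge0 _ _.
have r3 : r ^+ 3 = 1 - p.
  rewrite -powR_mulrn // -powRrM (_ : 3^-1 * 3 = 1); last by field.
  by rewrite powRr1 // subr_ge0.
have r1 : r < 1.
  rewrite ltNge; apply/negP => r1.
  have : 1 <= r ^+ 3 by apply: exprn_ege1.
  by rewrite r3; lra.
have pE : p = 1 - r ^+ 3 by rewrite r3; ring.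
have r2 : 0 <= r * r by rewrite mulr_ge0.
have rr : r * r <= r by rewrite ler_piMl // ltW.
have rrr : r * (r * r) <= r * r by rewrite ler_wpM2l // (le_trans rr) // ltW.
exists (1 - r); split; try lra.
rewrite pE -subr_ge0.
have -> : 3 * (1 - r) - (1 - r ^+ 3) = (1 - r) ^+ 2 * (r + 2) by ring.
by rewrite mulr_ge0 ?sqr_ge0 // addr_ge0.
Qed.

Lemma failure_probability_le (n k : nat) (K : R) : (2 < n)%N -> 1 <= K ->
  n%:R <= K ^+ k -> n.+1%:R * (10 * n%:R * (K ^- 20) ^+ k) <= n%:R ^- 7.
Proof.
move=> n2 K1 nK.
have n0 : 0 < n%:R :> R by rewrite ltr0n (ltn_trans _ n2).
have K0 : 0 < K by apply: lt_le_trans K1.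
have h : (K ^- 20) ^+ k <= n%:R ^- 20.
  rewrite exprVn -exprM mulnC exprM lef_pV2 ?posrE ?exprn_gt0 //.
  by apply: lerXn2r => //; rewrite nnegrE; [apply: ltW | rewrite exprn_ge0 // ltW].
apply: (@le_trans _ _ (n.+1%:R * (10 * n%:R * n%:R ^- 20))).
  by apply: ler_wpM2l => //; apply: ler_wpM2l => //; rewrite mulr_ge0.
rewrite !mulrA ler_pdivrMr ?exprn_gt0 //.
have -> : n%:R ^- 7 * n%:R ^+ 20 = n%:R ^+ 13 :> R.
  by rewrite (exprD _ 7 13) mulrA mulVf ?mul1r // expf_neq0 // gt_eqF.
rewrite -!natrM -natrX ler_nat.
have n3 : (10 <= n ^ 3)%N by apply: (@leq_trans (3 ^ 3)%N); rewrite ?leq_exp2r.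
have n1 : (n.+1 <= n ^ 2)%N by rewrite expnS expn1; nia.
apply: (@leq_trans (n ^ 2 * n ^ 3 * n)%N).
  by rewrite leq_mul2r leq_mul ?orbT.
by rewrite -expnD -expnSr leq_exp2l // (ltn_trans _ n2).
Qed.

End Numerics.

(** * Choice of the parameters and conclusion *)

Theorem theorem11p5 (R : realType) (V : finType) (e : rel V)
    (e_sym : symmetric e) (e_irr : irreflexive e)
    (n : nat) (card_V : #|V| = n) (n_gt2 : (2 < n)%N)
    (zeta : R) (G_expander : expander zeta e)
    (zeta_le : zeta <= 1 / ln n%:R)
    (dmin_ge : 4 * 10 ^+ 6 * zeta^-1 * n%:R `^ (32 / ln (ln n%:R))
               <= (min_degree e)%:R)
    (s : nat) (s_le_n : (s <= n)%N)
    (s_ge : 4 * 10 ^+ 6 * zeta^-1 * n%:R `^ (32 / ln (ln n%:R))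
              / (min_degree e)%:R * n%:R <= s%:R) :
  1 - n%:R ^- 7 <=
  prob_random_subset R s (fun C : {set V} =>
    expander (zeta / n%:R `^ (1024 / ln (ln n%:R))) (induced e C)
    && (s%:R / (2 * n%:R) * (min_degree e)%:R
          <= (min_degree (induced e C))%:R :> R)).
Proof.
have [K [k [powE K2 kK nK]]] := lnln_root R n_gt2.
rewrite (powE 32) in dmin_ge s_ge; rewrite (powE 1024).
have /andP[/andP[zeta0 zeta1] _] := G_expander.
have K1 : 1 <= K by apply: le_trans K2; rewrite ler1n.
have K0 : 0 < K by apply: lt_le_trans K1.
have n0 : 0 < n%:R :> R by rewrite ltr0n (ltn_trans _ n_gt2).
have V1 : (1 < #|V|)%N by rewrite card_V (ltn_trans _ n_gt2).
set M : R := 4 * 10 ^+ 6 in dmin_ge s_ge.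
(* The product 20 * 242 is the constant in the bound on rho, and 3 comes from [p <= 3 * q]. *)
have M_ge : 20 * 242 * 3 <= M by rewrite /M !exprS expr0; lra.
have M0 : 0 < M by apply: lt_le_trans M_ge; rewrite !mulr_gt0.
have K32 : 0 < K ^+ 32 by rewrite exprn_gt0.
set dm : R := (min_degree e)%:R in dmin_ge s_ge *.
have dm0 : 0 < dm by apply: lt_le_trans dmin_ge; rewrite !mulr_gt0 ?invr_gt0.
have dm_le u : dm <= (degree e u)%:R by rewrite ler_nat min_degree_le.
have [u0 _] : exists u : V, true by move/ltnW: V1 => /card_gt0P[u _]; exists u.
have dmn : dm <= n%:R by apply: le_trans (dm_le u0) _; rewrite -card_V ler_nat max_card.
pose p : R := s%:R / n%:R.
have p_ge : M * K ^+ 32 <= zeta * dm * p.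
  have -> : zeta * dm * p = s%:R * (zeta * dm / n%:R) by rewrite /p; ring.
  have -> : M * K ^+ 32 = M / zeta * K ^+ 32 / dm * n%:R * (zeta * dm / n%:R).
    by field; rewrite !gt_eqF.
  by apply: ler_wpM2r => //; rewrite divr_ge0 ?mulr_ge0 // ltW.
have p0 : 0 < p.
  have : 0 < zeta * dm * p by apply: lt_le_trans p_ge; rewrite mulr_gt0.
  by rewrite pmulr_rgt0 // mulr_gt0.
have p1 : p <= 1 by rewrite ler_pdivrMr // mul1r ler_nat.
(* A second eigenvalue of [G[C]] requires two vertices; here [s] is at least [zeta * dm * p],
   because [dm <= n] and [zeta <= 1]. *)
have s_ge2 : (1 < s)%N.
  rewrite -(ltr_nat R); apply: (@lt_le_trans _ _ (M * K ^+ 32)).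
    apply: (@lt_le_trans _ _ (M * 1)); first by rewrite mulr1; lra.
    by apply: ler_wpM2l; [apply: ltW | apply: exprn_ege1].
  apply: le_trans p_ge _; rewrite /p mulrA ler_pdivrMr //.
  rewrite mulrC; apply: ler_wpM2l => //.
  by rewrite -[leRHS]mul1r; apply: ler_pM => //; apply: ltW.
have [q [q0 q1 p3q qp pE]] := union_rate p0 p1.
pose rho : R := K ^- 20.
have rho_le : rho <= 1 / 4.
  rewrite mul1r lef_pV2 ?posrE ?exprn_gt0 //.
  apply: (@le_trans _ _ (K ^+ 2)); last by apply: ler_weXn2l.
  have -> : 4 = 2 ^+ 2 :> R by rewrite expr2 -natrM.
  by apply: lerXn2r; rewrite ?nnegrE // ltW.
have rho_ge : 20 * k%:R * 242 / (zeta * dm * q) <= rho.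
  have den : M * K ^+ 32 / 3 <= zeta * dm * q.
    rewrite ler_pdivrMr //; apply: le_trans p_ge _.
    by rewrite -[leRHS]mulrA [q * 3]mulrC; apply: ler_wpM2l => //; rewrite mulr_ge0 ?ltW.
  have den0 : 0 < zeta * dm * q by rewrite !mulr_gt0.
  rewrite ler_pdivrMr //.
  apply: (@le_trans _ _ (rho * (M * K ^+ 32 / 3))); last first.
    by apply: ler_wpM2l => //; rewrite invr_ge0 exprn_ge0 // ltW.
  have -> : rho * (M * K ^+ 32 / 3) = M / 3 * K ^+ 12.
    rewrite /rho (exprD K 20 12); field.
    by rewrite gt_eqF.
  have k12 : k%:R <= K ^+ 12 by apply: le_trans kK _; apply: ler_weXn2l.
  have -> : 20 * k%:R * 242 = 20 * 242 * k%:R :> R by ring.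
  by apply: ler_pM => //; rewrite ?mulr_ge0 // ler_pdivlMr.
have gap0 : tri_gap e (zeta / 2) (fun=> 1) (fun=> 1) (fun=> 1).
  apply: tri_gap_init => //; apply: expander_dirichlet => // u.
  by rewrite -(ltr0n R); apply: lt_le_trans (dm_le u).
have fail := induced_gap_probability e_sym zeta0 zeta1 dm0 dm_le q0 q1 rho_le rho_ge
  p0 p1 p3q pE qp gap0.
pose good (C : {set V}) :=
  `[< degree_ok e (sampled p C) /\ induced_gap e (zeta / 2662 / 27) C >].
have sV : (s <= #|V|)%N by rewrite card_V.
apply: (le_trans _ (@prob_random_subset_ge R V s _ good (ltnW V1) sV _)); last first.
- move=> C Cs /asboolP[dok gapC].
  have cardC : #|{: {u | u \in C}}| = s by rewrite card_sig Cs.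
  have deg_ge (u : {u | u \in C}) : p / 2 * dm <= (degree (induced e C) u)%:R.
    have /andP[+ _] := dok (val u).
    rewrite weighted_degree_sampled -degree_induced ler_pdivlMr // => h.
    by apply: le_trans h; have := ler_wpM2r (ltW p0) (dm_le (val u)); lra.
  have pdm0 : 0 < p / 2 * dm by rewrite mulr_gt0 // divr_gt0.
  apply/andP; split; last first.
    have -> : s%:R / (2 * n%:R) * dm = p / 2 * dm by rewrite /p; field; rewrite gt_eqF.
    apply: le_min_degree => //; rewrite cardC /p.
    have -> : s%:R / n%:R / 2 * dm = s%:R * (dm / n%:R / 2) by ring.
    apply: ler_piMr => //; rewrite !ler_pdivrMr // mul1r; lra.
  (* The accumulated loss is [2662 * 27] with [2662 = 2 * 11 ^ 3]; it is below [2 ^ 17], hence below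
     [K ^+ 17]. *)
  have lam_le : zeta / K ^+ 1024 <= zeta / 2662 / 27.
    have -> : zeta / 2662 / 27 = zeta / (2662 * 27) by field.
    apply: ler_wpM2l; first exact: ltW.
    rewrite lef_pV2 ?posrE ?mulr_gt0 ?exprn_gt0 //.
    apply: (@le_trans _ _ (2 ^+ 12 * 2 ^+ 5)).
      by apply: ler_pM => //; rewrite -natrX ler_nat.
    rewrite -exprD; apply: (@le_trans _ _ (K ^+ 17)).
      by apply: lerXn2r; rewrite ?nnegrE // ltW.
    by apply: ler_weXn2l.
  have K1024 : 0 < K ^+ 1024 by rewrite exprn_gt0.
  apply: dirichlet_expander => //.
  - by move=> u v; rewrite /induced /= e_sym.
  - by move=> u; rewrite -(ltr0n R); apply: lt_le_trans (deg_ge u).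
  - by rewrite cardC.
  - rewrite divr_gt0 //= ler_pdivrMr // mul1r (le_trans zeta1) //.
    exact: exprn_ege1.
  move=> f; have [t ht] := gapC f; exists t; apply: le_trans ht.
  apply: ler_wpM2r => //; apply: sumr_ge0 => u _.
  by rewrite mulr_ge0 ?sqr_ge0.
rewrite lerD2l lerN2 card_V.
apply: le_trans (failure_probability_le n_gt2 K1 nK).
apply: ler_wpM2l => //; rewrite card_V in fail; apply: le_trans fail.
rewrite -/p le_eqVlt; apply/orP; left; apply/eqP; apply: eq_expect => C.
by rewrite asbool_neg.
Qed.
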